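(* Let $T$ be an o-minimal theory in a language $\mathcal L$ expanding the language of ordered abelian groups, let $U$ be a unary relation symbol not in $\mathcal L$, let $T_U$ be a complete $\mathcal L(U)$-theory (where $\mathcal L(U)=\mathcal L\cup\{U\}$) expanding $T$, and let $\mathbb M$ be a monster model of $T_U$. Suppose: \begin{enumerate} \item $U(\mathbb M)$ is small and dense in $\mathbb M$; \item for every $n\in\mathbb N$, every (small) $C\subseteq\mathbb M$, and all $a,b\in\mathbb M^n$ which are both $\operatorname{dcl}_{\mathcal L}$-independent over $C\cup U(\mathbb M)$, if $\mathrm{tp}_{\mathcal L}(a|C)=\mathrm{tp}_{\mathcal L}(b|C)$ then $\mathrm{tp}_{\mathcal L(U)}(a|C)=\mathrm{tp}_{\mathcal L(U)}(b|C)$. \end{enumerate} Then $T_U$ is not distal.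
   Context: $U(\mathbb M)$ is the interpretation of $U$ in $\mathbb M$. An $\mathcal L(U)$-definable set $X\subseteq\mathbb M$ is small if there is no $\mathcal L$-definable (with parameters) function $f:\mathbb M^m\to\mathbb M$ such that $f(X^m)$ contains an open interval. Dense means dense in the order topology. $\operatorname{dcl}_{\mathcal L}$ is the $\mathcal L$-definable closure in $\mathbb M$ (a pregeometry since $T$ is o-minimal); a tuple $a=(a_1,\dots,a_n)$ is $\operatorname{dcl}_{\mathcal L}$-independent over $X$ if the set $\{a_1,\dots,a_n\}$ is independent over $X$ in this pregeometry (the $a_i$ distinct and no $a_i$ in $\operatorname{dcl}_{\mathcal L}(X\cup\{a_j:j\ne i\})$). A complete theory with monster model $\mathbb M$ is distal if for every small $A\subseteq\mathbb M$ and every indiscernible sequence $(a_i)_{i\in I}$ from $\mathbb M^p$ with $I=I_1+(c)+I_2$ (concatenation, $I_1,I_2$ infinite linear orders without endpoints, $c$ a single element) such that $(a_i)_{i\in I_1+I_2}$ is $A$-indiscernible, the whole sequence $(a_i)_{i\in I}$ is $A$-indiscernible.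
   Formalization: The o-minimal theory T is assumed to extend the theory of ordered abelian groups, not merely to be in a language containing its symbols; with + interpreted as a constant on a dense linear order the claim fails. *)

(* Defs.v *)
From mathcomp Require Import all_boot matrix.
From mathcomp Require Import boolp classical_sets functions cardinality.

Set Implicit Arguments.
Unset Strict Implicit.
Unset Printing Implicit Defensive.

Local Open Scope classical_set_scope.
Local Open Scope card_scope.

Record language := Language {
  fsym : Type; far : fsym -> nat;
  rsym : Type; rar : rsym -> nat }.

Inductive term (L : language) (n : nat) : Type :=
| Var of 'I_n
| App (f : fsym L) of ('I_(far f) -> term L n).

(* [formula L n]: formulas with free variables among n variables.  The
   variable bound by [All] has index 0 in the body, the free variables are
   shifted by one. *)
Inductive formula (L : language) : nat -> Type :=
| Bot n : formula L n
| Eq n of term L n & term L n : formula L n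
| Rel n (r : rsym L) of ('I_(rar r) -> term L n) : formula L n
| Imp n of formula L n & formula L n : formula L n
| All n of formula L n.+1 : formula L n.

Definition sentence (L : language) := formula L 0.
Definition Not L n (phi : formula L n) : formula L n := Imp phi (Bot L n).

Record structure (L : language) := Structure {
  carrier :> Type;
  carrier_inhabited : inhabited carrier;
  fint : forall f : fsym L, ('I_(far f) -> carrier) -> carrier;
  rint : forall r : rsym L, ('I_(rar r) -> carrier) -> Prop }.
Arguments fint {L} s f _.
Arguments rint {L} s r _.

Section Semantics.
Variables (L : language) (M : structure L).

Fixpoint eval n (v : 'I_n -> M) (t : term L n) : M :=
  match t with
  | Var i => v i
  | App f ts => fint M f (fun j => eval v (ts j))
  end.

Definition scons n (x : M) (v : 'I_n -> M) : 'I_n.+1 -> M :=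
  fun i => if unlift ord0 i is Some j then v j else x.

Fixpoint sat n (phi : formula L n) : ('I_n -> M) -> Prop :=
  match phi in formula _ n return ('I_n -> M) -> Prop with
  | Bot _ => fun _ => False
  | Eq _ s t => fun v => eval v s = eval v t
  | Rel _ r ts => fun v => rint M r (fun j => eval v (ts j))
  | Imp _ phi psi => fun v => sat phi v -> sat psi v
  | All _ phi => fun v => forall x, sat phi (scons x v)
  end.

Definition holds (s : sentence L) : Prop := forall v, sat s v.

Definition tcat n m (x : 'I_n -> M) (y : 'I_m -> M) : 'I_(n + m) -> M :=
  fun i => match fintype.split i with inl j => x j | inr k => y k end.

(* formulas in n free variables with parameters from A *)
Record pformula (A : set M) (n : nat) := PFormula {
  npar : nat;
  pbody : formula L (n + npar);
  pval : 'I_npar -> M;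
  pvalP : forall i, A (pval i) }.

Definition psat A n (phi : pformula A n) (x : 'I_n -> M) : Prop :=
  sat (pbody phi) (tcat x (@pval _ _ phi)).

Definition definable (A : set M) n (X : set ('I_n -> M)) : Prop :=
  exists phi : pformula A n, X = [set x | psat phi x].

Definition definable1 (A : set M) (X : set M) : Prop :=
  definable A [set v : 'I_1 -> M | X (v ord0)].

Definition definable_fun (A : set M) n (f : ('I_n -> M) -> M) : Prop :=
  definable A [set v : 'I_n.+1 -> M | v ord0 = f (fun i => v (lift ord0 i))].

Definition tp (A : set M) n (a : 'I_n -> M) : set (pformula A n) :=
  [set phi | psat phi a].

Definition dcl (A : set M) : set M := [set b | definable1 A [set b]].

Definition dcl_independent (X : set M) n (a : 'I_n -> M) : Prop :=
  injective a /\
  forall i, ~ dcl (X `|` [set a j | j in [set j | j != i]]) (a i).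

Definition automorphism (s : M -> M) : Prop :=
  [/\ bijective s,
      forall f v, s (fint M f v) = fint M f (s \o v) &
      forall r v, rint M r v <-> rint M r (s \o v)].

Definition partial_elementary (A : set M) (f : M -> M) : Prop :=
  forall n (phi : formula L n) (v : 'I_n -> M),
    (forall i, A (v i)) -> (sat phi v <-> sat phi (f \o v)).

End Semantics.
Arguments sat {L} M {n} phi v.
Arguments psat {L M A n} phi x.
Arguments definable {L} M A {n} X.
Arguments definable1 {L} M A X.
Arguments definable_fun {L} M A {n} f.
Arguments tp {L} M A {n} a _.
Arguments dcl {L} M A _.
Arguments dcl_independent {L} M X {n} a.
Arguments automorphism {L} M s.
Arguments partial_elementary {L} M A f.

Definition theory (L : language) := set (sentence L).

Definition models L (M : structure L) (T : theory L) : Prop :=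
  forall s, T s -> holds M s.

Definition entails L (T : theory L) (s : sentence L) : Prop :=
  forall M : structure L, models M T -> holds M s.

Definition complete_theory L (T : theory L) : Prop :=
  (exists M : structure L, models M T) /\
  forall s, entails T s \/ entails T (Not s).

(* Cardinals are represented by types: [K] stands for the cardinal |K|. *)
Definition card_lt (S K : Type) (A : set S) : Prop :=
  (A #<= [set: K]) /\ ~ ([set: K] #<= A).
Arguments card_lt {S} K A.

Definition saturated (K : Type) L (M : structure L) : Prop :=
  forall A : set M, card_lt K A ->
  forall n (p : set (pformula A n)),
    (forall q, q `<=` p -> finite_set q ->
       exists x, forall phi, q phi -> psat phi x) ->
    exists x, forall phi, p phi -> psat phi x.

Definition strongly_homogeneous (K : Type) L (M : structure L) : Prop :=
  forall (A : set M) (f : M -> M), card_lt K A -> partial_elementary M A f ->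
    exists2 s, automorphism M s & forall x, A x -> s x = f x.

(* The summand [nat] makes |K| uncountable, even for a finite language. *)
Definition monster_model (K : Type) L (T : theory L) (M : structure L) : Prop :=
  [/\ models M T,
      card_lt K [set: fsym L + rsym L + nat],
      saturated K M &
      strongly_homogeneous K M].

Definition linear_order (I : Type) (lt : I -> I -> Prop) : Prop :=
  [/\ forall x, ~ lt x x,
      forall x y z, lt x y -> lt y z -> lt x z &
      forall x y, [\/ lt x y, x = y | lt y x]].

Definition no_endpoints (I : Type) (lt : I -> I -> Prop) : Prop :=
  forall x, (exists y, lt y x) /\ (exists z, lt x z).

Definition dense_order (I : Type) (lt : I -> I -> Prop) : Prop :=
  forall x y, lt x y -> exists z, lt x z /\ lt z y.

Definition sum_lt I J (ltI : I -> I -> Prop) (ltJ : J -> J -> Prop)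
    (u v : I + J) : Prop :=
  match u, v with
  | inl x, inl y => ltI x y
  | inl _, inr _ => True
  | inr _, inl _ => False
  | inr x, inr y => ltJ x y
  end.

Definition unit_lt (_ _ : unit) : Prop := False.

(* the k p-tuples b_0, ..., b_(k-1) as a single tuple of length k * p *)
Definition tflatten (M : Type) k p (b : 'I_k -> 'I_p -> M) : 'I_(k * p) -> M :=
  fun t => mxvec (\matrix_(i, j) b i j) ord0 t.

Definition indiscernible L (M : structure L) (A : set M) p
    (I : Type) (lt : I -> I -> Prop) (a : I -> 'I_p -> M) : Prop :=
  forall k (s t : 'I_k -> I),
    (forall i j : 'I_k, i < j -> lt (s i) (s j)) ->
    (forall i j : 'I_k, i < j -> lt (t i) (t j)) ->
    tp M A (tflatten (a \o s)) = tp M A (tflatten (a \o t)).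
Arguments indiscernible {L} M A {p I} lt a.

(* the inclusion of I1 + I2 into I1 + (c) + I2 *)
Definition skip_middle (I1 I2 : Type) (i : I1 + I2) : I1 + (unit + I2) :=
  match i with inl x => inl x | inr y => inr (inr y) end.

(* Distality of a complete theory with |K|-monster model M. *)
Definition distal (K : Type) L (M : structure L) : Prop :=
  forall (A : set M) (p : nat) (I1 I2 : Type)
    (lt1 : I1 -> I1 -> Prop) (lt2 : I2 -> I2 -> Prop)
    (a : I1 + (unit + I2) -> 'I_p -> M),
    card_lt K A ->
    linear_order lt1 -> infinite_set [set: I1] -> no_endpoints lt1 ->
    linear_order lt2 -> infinite_set [set: I2] -> no_endpoints lt2 ->
    indiscernible M set0 (sum_lt lt1 (sum_lt unit_lt lt2)) a ->
    indiscernible M A (sum_lt lt1 lt2) (a \o @skip_middle I1 I2) ->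
    indiscernible M A (sum_lt lt1 (sum_lt unit_lt lt2)) a.

(* Languages expanding (<, 0, +); the existence of inverses is an axiom in
   [ordered_abelian_group], so that a symbol for - is allowed but not required. *)
Record oag_language := OAGLanguage {
  oag_lang :> language;
  zero_sym : fsym oag_lang; zero_ar : far zero_sym = 0;
  add_sym : fsym oag_lang; add_ar : far add_sym = 2;
  lt_sym : rsym oag_lang; lt_ar : rar lt_sym = 2 }.

Section OrderedGroups.
Variables (L : oag_language) (M : structure L).

Definition mzero : M :=
  fint M (zero_sym L) (tnth [tuple] \o cast_ord (zero_ar L)).
Definition madd (x y : M) : M :=
  fint M (add_sym L) (tnth [tuple x; y] \o cast_ord (add_ar L)).
Definition mlt (x y : M) : Prop :=
  rint M (lt_sym L) (tnth [tuple x; y] \o cast_ord (lt_ar L)).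

Definition ordered_abelian_group : Prop :=
  [/\ associative madd, commutative madd, left_id mzero madd &
      forall x, exists y, madd y x = mzero] /\
  linear_order mlt /\
  forall x y z, mlt x y -> mlt (madd z x) (madd z y).

(* The open interval with endpoints a and b; [None] stands for -oo as the
   left endpoint and for +oo as the right endpoint. *)
Definition open_interval (a b : option M) : set M :=
  [set x | (if a is Some a' then mlt a' x else True) /\
           (if b is Some b' then mlt x b' else True)].

Definition o_minimal : Prop :=
  [/\ linear_order mlt, dense_order mlt, no_endpoints mlt &
      forall X : set M, definable1 M setT X ->
        exists k l (p : 'I_k -> M) (e : 'I_l -> option M * option M),
          X = range p `|` \bigcup_j open_interval (e j).1 (e j).2].

(* the open intervals are the standard base of the order topology *)
Definition order_dense (X : set M) : Prop :=
  forall a b, open_interval a b !=set0 -> (open_interval a b `&` X) !=set0.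

Definition small_set (X : set M) : Prop :=
  ~ exists m (f : ('I_m -> M) -> M) (a b : option M),
    [/\ definable_fun M setT f,
        open_interval a b !=set0 &
        open_interval a b `<=` f @` [set v | forall i, X (v i)]].

End OrderedGroups.
Arguments small_set {L} M X.
Arguments order_dense {L} M X.

Definition extends_oag (L : oag_language) (T : theory L) : Prop :=
  forall M : structure L, models M T -> ordered_abelian_group M.

Definition o_minimal_theory (L : oag_language) (T : theory L) : Prop :=
  forall M : structure L, models M T -> o_minimal M.

(* [None] is the new unary relation symbol. *)
Definition langU (L : language) : language :=
  {| fsym := fsym L; far := @far L;
     rsym := option (rsym L);
     rar := fun r => if r is Some r' then rar r' else 1 |}.

Fixpoint termU (L : language) n (t : term L n) : term (langU L) n :=
  match t with
  | Var i => Var (langU L) i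
  | App f ts => @App (langU L) n f (fun j => termU (ts j))
  end.

Fixpoint formulaU (L : language) n (phi : formula L n) : formula (langU L) n :=
  match phi with
  | Bot n => Bot (langU L) n
  | Eq _ s t => Eq (termU s) (termU t)
  | Rel n r ts => @Rel (langU L) n (Some r) (fun j => termU (ts j))
  | Imp _ phi psi => Imp (formulaU phi) (formulaU psi)
  | All _ phi => All (formulaU phi)
  end.

Definition expands (L : language) (TU : theory (langU L)) (T : theory L) :=
  forall s, T s -> entails TU (formulaU s).

Definition reduct (L : language) (M : structure (langU L)) : structure L :=
  @Structure L M (carrier_inhabited M) (fun f : fsym L => @fint (langU L) M f)
    (fun r : rsym L => @rint (langU L) M (Some r)).

Definition Uset (L : language) (M : structure (langU L)) : set M :=
  [set x | @rint (langU L) M None (fun _ : 'I_1 => x)].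
Arguments Uset {L} M _.

(* Main.v *)
Require Import Defs.
From mathcomp Require Import all_boot order ssralg ssrnum rat matrix.
From mathcomp Require Import boolp classical_sets functions cardinality.

(** Take [h_0], [h_1], [h_2], ... in [M], each larger than every element of
    [dcl] of its predecessors; by o-minimality such a sequence is
    [L]-indiscernible.  By smallness the even-numbered terms can be chosen
    outside [dcl] of [U] and the predecessors, and by density the odd-numbered
    ones can be chosen in [h_0 + U].  Stretching along an order of type
    [1 + Q + 1 + Q], with odd-numbered terms at the middle place [c] only,
    gives [b], [a_i] ([i] in [Q + 1 + Q]), an [L]-indiscernible sequence with
    [b] and the [a_i], [i <> c], independent over [U] and [a_c] in [b + U].
    By exchange all the [a_i] are independent over [U], so by the type
    hypothesis the whole sequence is indiscernible over the empty set, and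
    without [a_c] it is indiscernible over [b].  But [x] in [b + U] holds at
    [a_c] and at no other [a_i]. *)

Set Implicit Arguments.
Unset Strict Implicit.
Unset Printing Implicit Defensive.

Local Open Scope classical_set_scope.

(** The obstacle is that [U] is not a small set, so saturation cannot be applied over it. Lying
    outside [dcl] of [U] and finitely many elements is therefore expressed with the elements of [U]
    quantified: every [L]-formula contributes one [L(U)]-condition whose only parameters are those
    finitely many elements. Such a condition excludes only points in the image of a power of [U]
    under an [L]-definable function. Finitely many such images lie in a single one, which by
    smallness contains no interval, so the conditions are finitely satisfiable beyond every point.
    As the conditions no longer mention elements of [U], compactness also preserves them when the
    sequence is stretched. Indiscernibility in [L] needs no Ramsey argument: a definable subset of
    the line either contains a final segment or misses one, so an element above [dcl] of a set has a
    determined [L]-type over it. *)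

(** * Definability with arbitrary index types *)

Section Renaming.
Variables (L : language) (M : structure L).

Fixpoint trename n m (r : 'I_n -> 'I_m) (t : term L n) : term L m :=
  match t with
  | Var i => Var L (r i)
  | App f ts => App (fun j => trename r (ts j))
  end.

Definition rename_up n m (r : 'I_n -> 'I_m) (i : 'I_n.+1) : 'I_m.+1 :=
  if unlift ord0 i is Some j then lift ord0 (r j) else ord0.

Fixpoint rename n (phi : formula L n) : forall m, ('I_n -> 'I_m) -> formula L m :=
  match phi in formula _ n return forall m, ('I_n -> 'I_m) -> formula L m with
  | Bot _ => fun m r => Bot L m
  | Eq _ s t => fun m r => Eq (trename r s) (trename r t)
  | Rel _ q ts => fun m r => Rel (fun j => trename r (ts j))
  | Imp _ phi psi => fun m r => Imp (rename phi r) (rename psi r)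
  | All _ phi => fun m r => All (rename phi (rename_up r))
  end.

Lemma eval_trename n m (r : 'I_n -> 'I_m) (v : 'I_m -> M) t :
  eval v (trename r t) = eval (v \o r) t.
Proof. by elim: t => //= f ts IH; congr fint; apply: funext => j. Qed.

Lemma scons_rename_up n m (r : 'I_n -> 'I_m) (v : 'I_m -> M) x :
  scons x v \o rename_up r = scons x (v \o r).
Proof.
apply: funext => i; rewrite /scons /rename_up /=.
by case: (unliftP ord0 i) => [j|] _; rewrite ?liftK ?unlift_none.
Qed.

Lemma sat_rename n (phi : formula L n) m (r : 'I_n -> 'I_m) (v : 'I_m -> M) :
  sat M (rename phi r) v <-> sat M phi (v \o r).
Proof.
elim: phi m r v => {n} [n|n s t|n q ts|n phi IH psi IH'|n phi IH] m r v //=.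
- by rewrite !eval_trename.
- suff -> : (fun j => eval v (trename r (ts j))) = fun j => eval (v \o r) (ts j) by [].
  by apply: funext => j; rewrite eval_trename.
- by rewrite IH IH'.
- by split=> H x; move: (H x); rewrite IH scons_rename_up.
Qed.

Lemma sat_congr n (phi : formula L n) (v v' : 'I_n -> M) :
  v =1 v' -> sat M phi v -> sat M phi v'.
Proof. by move=> /funext ->. Qed.

End Renaming.

Section DefinableSets.
Variables (L : language) (M : structure L).
Implicit Types (A B : set M).

Definition ord_empty T (i : 'I_0) : T := match notF (ltn_ord i) with end.

Definition look A W (w : W -> M) (s : W + {x | A x}) : M :=
  match s with inl x => w x | inr p => sval p end.

(* Definability over [A] with variables drawn from an arbitrary type [W]; only
   finitely many of them occur. *)
Definition df A W (Z : (W -> M) -> Prop) : Prop :=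
  exists n (phi : formula L n) (s : 'I_n -> W + {x | A x}),
    forall w, Z w <-> sat M phi (fun i => look w (s i)).

(* a variable or a parameter *)
Definition vp A W (E : (W -> M) -> M) := exists s : W + {x | A x}, forall w, E w = look w s.

Lemma vp_var A W (x : W) : vp A (fun w => w x).
Proof. by exists (inl x). Qed.

Lemma vp_par A W p : A p -> vp A (fun _ : W -> M => p).
Proof. by move=> Ap; exists (inr (exist _ p Ap)). Qed.

Lemma df_ext A W (Z Z' : (W -> M) -> Prop) :
  (forall w, Z w <-> Z' w) -> df A Z -> df A Z'.
Proof. by move=> h; rewrite (_ : Z' = Z) //; apply: funext => w; apply: propext; rewrite h. Qed.

Lemma df_sub A B V W (Z : (V -> M) -> Prop) (E : V -> (W -> M) -> M) :
  df A Z -> A `<=` B -> (forall i, vp B (E i)) -> df B (fun w => Z (fun i => E i w)).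
Proof.
move=> [n [phi [s h]]] AB /choice[t ht].
exists n, phi, (fun i => match s i with
  | inl x => t x
  | inr p => inr (exist _ (sval p) (AB _ (svalP p))) end) => w.
rewrite h; suff -> : (fun i => look (E^~ w) (s i)) = (fun i => look w
  (match s i with inl x => t x | inr p => inr (exist _ (sval p) (AB _ (svalP p))) end)) by [].
by apply: funext => i; case: (s i) => //= x.
Qed.

Lemma df_mono A B W (Z : (W -> M) -> Prop) : A `<=` B -> df A Z -> df B Z.
Proof. by move=> AB dZ; apply: (df_sub (E := fun i w => w i) dZ AB) => i; apply: vp_var. Qed.

Lemma df_re A V W (Z : (V -> M) -> Prop) (r : V -> W) :
  df A Z -> df A (fun w => Z (fun i => w (r i))).
Proof. by move=> dZ; apply: (df_sub (E := fun i w => w (r i)) dZ) => // i; apply: vp_var. Qed.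

Lemma df_bot A W : df A (fun _ : W -> M => False).
Proof. by exists 0, (Bot L 0), (@ord_empty _). Qed.

Lemma df_imp A W (Y Z : (W -> M) -> Prop) :
  df A Y -> df A Z -> df A (fun w => Y w -> Z w).
Proof.
move=> [n [phi [s hs]]] [m [psi [t ht]]].
exists (n + m)%N, (Imp (rename phi (@lshift n m)) (rename psi (@rshift n m))).
exists (fun i => match fintype.split i with inl j => s j | inr k => t k end) => w /=.
rewrite !sat_rename hs ht.
have el : (fun i => look w (match fintype.split i with inl j => s j | inr k => t k end))
  \o @lshift n m = fun i => look w (s i).
  by apply: funext => i /=; rewrite (unsplitK (inl i)).
have er : (fun i => look w (match fintype.split i with inl j => s j | inr k => t k end))
  \o @rshift n m = fun i => look w (t i).
  by apply: funext => i /=; rewrite (unsplitK (inr i)).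
by rewrite el er.
Qed.

Lemma df_not A W (Y : (W -> M) -> Prop) : df A Y -> df A (fun w => ~ Y w).
Proof. by move=> dY; apply: df_imp => //; apply: df_bot. Qed.

Lemma df_or A W (Y Z : (W -> M) -> Prop) :
  df A Y -> df A Z -> df A (fun w => Y w \/ Z w).
Proof.
move=> dY dZ; apply: df_ext (df_imp (df_not dY) dZ) => w; split=> [h|[]//].
by have [y|/h] := pselect (Y w); [left|right].
Qed.

Lemma df_and A W (Y Z : (W -> M) -> Prop) :
  df A Y -> df A Z -> df A (fun w => Y w /\ Z w).
Proof.
move=> dY dZ; apply: df_ext (df_not (df_or (df_not dY) (df_not dZ))) => w.
split=> [h|[y z] []//]; split; apply: contrapT => n; apply: h; by [left|right].
Qed.

Lemma df_iff A W (Y Z : (W -> M) -> Prop) :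
  df A Y -> df A Z -> df A (fun w => Y w <-> Z w).
Proof. by move=> dY dZ; apply: df_and; apply: df_imp. Qed.

Definition ocons W (x : M) (w : W -> M) (i : option W) := if i is Some j then w j else x.

Lemma ocons_eta W (w : option W -> M) : ocons (w None) (fun i => w (Some i)) = w.
Proof. by apply: funext => -[]. Qed.

Lemma df_all A W (Z : M -> (W -> M) -> Prop) :
  df A (fun w : option W -> M => Z (w None) (fun i => w (Some i))) ->
  df A (fun w => forall x, Z x w).
Proof.
move=> [n [phi [s hs]]].
(* The value list of the quantified formula needs an entry even at the positions of the bound
   variable, and [d] fills these. Without any variable or parameter to serve as [d], every position
   is the bound variable. *)
have [[d]|nd] := pselect (inhabited (W + {x | A x})).
  pose r (i : 'I_n) : 'I_n.+1 := if s i is inl None then ord0 else lift ord0 i.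
  pose t (i : 'I_n) : W + {x | A x} := match s i with
    | inl (Some x) => inl x | inl None => d | inr p => inr p end.
  exists n, (All (rename phi r)), t => w /=.
  split=> h x; move: (h x); rewrite sat_rename => {}h.
    have /hs {}h : (fun w0 : option W -> M => Z (w0 None) (fun i => w0 (Some i))) (ocons x w).
      by [].
    apply: sat_congr h => i; rewrite /= /r /t /scons.
    by case e: (s i) => [[j|]|p] /=; rewrite ?liftK ?unlift_none ?e.
  apply: ((hs (ocons x w)).2); apply: sat_congr h => i; rewrite /= /r /t /scons.
  by case e: (s i) => [[j|]|p] /=; rewrite ?liftK ?unlift_none ?e.
pose t (i : 'I_0) : W + {x | A x} := ord_empty _ i.
exists 0, (All (rename phi (fun _ => ord0))), t => w /=.
have e x : (fun i => look (ocons x w) (s i)) =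
    scons x (fun i => look w (t i)) \o (fun _ => ord0).
  apply: funext => i /=; rewrite /scons unlift_none.
  case: (s i) => [[j|]|p] //=; exfalso; apply: nd; constructor; by [left|right].
split=> h x; have := h x; rewrite sat_rename -e.
  by move=> {}h; apply: ((hs (ocons x w)).1).
by move/(hs (ocons x w)).2.
Qed.

Lemma df_ex A W (Z : M -> (W -> M) -> Prop) :
  df A (fun w : option W -> M => Z (w None) (fun i => w (Some i))) ->
  df A (fun w => exists x, Z x w).
Proof.
move=> dZ; apply: df_ext (df_not (df_all (Z := fun x w => ~ Z x w) (df_not dZ))) => w /=.
by split=> [/existsNP[x /contrapT zx]|[x zx] /(_ x)//]; exists x.
Qed.

Lemma df_eq A W (E F : (W -> M) -> M) : vp A E -> vp A F -> df A (fun w => E w = F w).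
Proof.
move=> [s hs] [t ht]; exists 2, (Eq (Var L ord0) (Var L (lift ord0 ord0))).
by exists (fun i => if i == ord0 then s else t) => w /=; rewrite hs ht.
Qed.

Lemma df_rel A W (q : rsym L) (E : 'I_(rar q) -> (W -> M) -> M) :
  (forall i, vp A (E i)) -> df A (fun w => rint M q (fun i => E i w)).
Proof.
move=> /choice[t ht]; exists (rar q), (@Rel L _ q (@Var L _)), t => w /=.
by rewrite (_ : (fun i => E i w) = fun j => look w (t j)) //; apply: funext.
Qed.

Lemma df_fun A W (f : Defs.fsym L) (E : 'I_(far f) -> (W -> M) -> M) F :
  (forall i, vp A (E i)) -> vp A F -> df A (fun w => F w = fint M f (fun i => E i w)).
Proof.
move=> /choice[t ht] [s hs].
exists (far f).+1, (Eq (Var L ord0) (@App L _ f (fun i => Var L (lift ord0 i)))).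
exists (fun i => if unlift ord0 i is Some j then t j else s) => w /=.
rewrite unlift_none -hs.
rewrite (_ : (fun i => E i w) = fun j => look w
  (match unlift ord0 (lift ord0 j) with Some j => t j | None => s end)) //.
by apply: funext => j; rewrite liftK.
Qed.

Definition sumcat V W (v : V -> M) (w : W -> M) (i : V + W) :=
  match i with inl x => v x | inr y => w y end.

Lemma df_ex_ord A V n (Z : (V + 'I_n -> M) -> Prop) :
  df A Z -> df A (fun v => exists w : 'I_n -> M, Z (sumcat v w)).
Proof.
elim: n V Z => [|n IH] V Z dZ.
  pose r (i : 'I_0) : V := ord_empty _ i.
  apply: df_ext (df_re (fun i => match i with inl x => x | inr y => r y end) dZ) => v.
  suff e (w : 'I_0 -> M) : sumcat v w =
      (fun i => v (match i with inl x => x | inr y => r y end)).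
    by split=> [h|[w]]; [exists (v \o r); rewrite e | rewrite e].
  by apply: funext => -[x|[]].
pose r (i : V + 'I_n.+1) : option V + 'I_n := match i with
  | inl x => inl (Some x)
  | inr y => if unlift ord0 y is Some j then inr j else inl None end.
pose Y x (v : V -> M) := exists w : 'I_n -> M, Z (fun i => sumcat (ocons x v) w (r i)).
have /df_ex : df A (fun v : option V -> M => Y (v None) (fun i => v (Some i))).
  by apply: df_ext (IH _ _ (df_re r dZ)) => v; rewrite /Y ocons_eta.
apply: df_ext => v; rewrite /Y.
have e (w : 'I_n -> M) x :
    (fun i => sumcat (ocons x v) w (r i)) = sumcat v (scons x w).
  by apply: funext => -[i|i] //=; rewrite /scons; case: unlift.
split=> [[x [w]]|[w zw]]; first by rewrite e; exists (scons x w).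
exists (w ord0), (fun i => w (lift ord0 i)); rewrite e.
suff -> : scons (w ord0) (fun i => w (lift ord0 i)) = w by [].
by apply: funext => i; rewrite /scons; case: (unliftP ord0 i) => [j|] ->.
Qed.

Lemma df_exs A V W (Z : (V + W -> M) -> Prop) :
  df A Z -> df A (fun v => exists w : W -> M, Z (sumcat v w)).
Proof.
move=> [n [phi [s hs]]].
have [x0] := carrier_inhabited M.
(* [t] picks one position for each variable that occurs. All positions with the same variable are
   redirected to it, so that quantifying over values of positions is quantifying over values of
   variables. *)
have /choice[t ht] : forall x, exists o : option 'I_n,
    if o is Some i then s i = inl (inr x) else forall i, s i <> inl (inr x).
  move=> x; have [[i hi]|nx] := pselect (exists i, s i = inl (inr x)).
    by exists (Some i).
  by exists None => i hi; apply: nx; exists i.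
pose s' i : V + 'I_n + {x | A x} := match s i with
  | inl (inl v) => inl (inl v)
  | inl (inr x) => inl (inr (odflt i (t x)))
  | inr p => inr p end.
have d : df A (fun w : V + 'I_n -> M => sat M phi (fun i => look w (s' i))).
  by exists n, phi, s'.
apply: df_ext (df_ex_ord d) => v; split=> [[w hw]|[w /hs hw]].
  exists (fun x => if t x is Some i then w i else x0); rewrite hs.
  apply: sat_congr hw => i; rewrite /s'.
  case e: (s i) => [[y|x]|p] //=; have := ht x; case: (t x) => [j|] //=.
  by move=> /(_ i).
exists (fun i => if s i is inl (inr x) then w x else x0).
apply: sat_congr hw => i; rewrite /s'.
case e: (s i) => [[y|x]|p] //=; have := ht x; case: (t x) => [j ->|/(_ i)] //=.
Qed.

Lemma df_finite_support A W (Z : (W -> M) -> Prop) : df A Z ->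
  exists n (s : 'I_n -> W), forall w w', (forall i, w (s i) = w' (s i)) -> Z w -> Z w'.
Proof.
move=> [n [phi [s hs]]].
have [[d]|nd] := pselect (inhabited W).
  exists n, (fun i => if s i is inl x then x else d) => w w' e /hs zw; apply/hs.
  apply: sat_congr zw => i; have := e i.
  by case: (s i).
exists 0, (@ord_empty _) => w w' _.
by rewrite (_ : w = w') //; apply: funext => i; case: nd.
Qed.

Lemma df_finite_params A W (Z : (W -> M) -> Prop) : df A Z ->
  exists m (p : 'I_m -> M) (Y : (W + 'I_m -> M) -> Prop),
    [/\ forall i, A (p i), df set0 Y & forall w, Z w <-> Y (sumcat w p)].
Proof.
move=> [n [phi [s hs]]].
have [[d Ad]|nA] := pselect (exists x, A x).
  exists n, (fun i => if s i is inr p then sval p else d).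
  pose s' i : W + 'I_n + {x : M | set0 x} := match s i with
    | inl x => inl (inl x) | inr p => inl (inr i) end.
  exists (fun w => sat M phi (fun i => look w (s' i))); split.
  - by move=> i; case: (s i) => // -[].
  - by exists n, phi, s'.
  - move=> w; rewrite hs.
    suff -> : (fun i => look w (s i)) = (fun i => look (sumcat w
      (fun i => if s i is inr p then sval p else d)) (s' i)) by [].
    by apply: funext => i; rewrite /s'; case e: (s i) => //=; rewrite e.
pose p0 (i : 'I_0) : M := ord_empty _ i.
pose s' i : W + 'I_0 + {x : M | set0 x} := match s i with
    | inl x => inl (inl x) | inr p => False_rect _ (nA (ex_intro _ _ (svalP p))) end.
exists 0, p0, (fun w => sat M phi (fun i => look w (s' i))); split.
- by case.
- by exists n, phi, s'.
- move=> w; rewrite hs.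
  suff -> : (fun i => look w (s i)) = (fun i => look (sumcat w p0) (s' i)) by [].
  by apply: funext => i; rewrite /s'; case e: (s i) => [|p] //; case: (nA);
    exists (sval p); exact: svalP.
Qed.

Lemma definableP A n (X : set ('I_n -> M)) : definable M A X <-> df A X.
Proof.
split=> [[phi ->]|dX].
  exists (n + npar phi)%N, (pbody phi), (fun i => match fintype.split i with
    | inl j => inl j | inr k => inr (exist _ (pval k) (pvalP k)) end) => w.
  rewrite /= /psat; suff -> : tcat w (pval (p:=phi)) = (fun i => look w
    (match fintype.split i with
    | inl j => inl j | inr k => inr (exist _ (pval k) (pvalP k)) end)) by [].
  by apply: funext => i; rewrite /tcat; case: fintype.split.
have [m [p [Y [Ap [k [phi [s hs]]] hY]]]] := df_finite_params dX.
pose r (i : 'I_k) : 'I_(n + m) := match s i with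
  | inl (inl j) => lshift m j | inl (inr j) => rshift n j
  | inr q => False_rect _ (svalP q) end.
exists (PFormula (rename phi r) Ap); apply: funext => w; apply: propext.
rewrite (_ : X w = Y (sumcat w p)); last exact/propext/hY.
rewrite hs /= /psat sat_rename /=.
suff -> : (fun i => look (sumcat w p) (s i)) = tcat w p \o r by [].
apply: funext => i; rewrite /= /r /tcat; case: (s i) => [[j|j]|q] /=.
- by rewrite (unsplitK (inl j)).
- by rewrite (unsplitK (inr j)).
- by case: (svalP q).
Qed.

Lemma definable1P A (X : set M) :
  definable1 M A X <-> df A (fun w : unit -> M => X (w tt)).
Proof.
rewrite /definable1 definableP; split=> d.
  exact: (df_re (fun=> tt) d).
exact: (df_re (fun=> ord0) d).
Qed.

End DefinableSets.

Ltac solve_vp := solve [exact: vp_var | by apply: vp_par; auto].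

Section Abstraction.
Variables (L : language) (M : structure L).
Implicit Types A B : set M.

(** Turns parameters into variables: those of [B] outside [A] are entries of [a], and the resulting
    [Y] can then be evaluated at other tuples. *)
Lemma df_abs A B W I (a : I -> M) (Z : (W -> M) -> Prop) :
  df B Z -> (forall x, B x -> A x \/ exists i, a i = x) ->
  exists Y, df A Y /\ forall w, Z w <-> Y (sumcat w a).
Proof.
move=> [n [phi [s hs]]] hB.
have /choice[t ht] : forall p : {x | B x}, exists q : I + {x | A x}, sval p = look a q.
  move=> [x Bx] /=; have [Ax|[i <-]] := hB x Bx; first by exists (inr (exist _ x Ax)).
  by exists (inl i).
pose s' i : W + I + {x | A x} := match s i with
  | inl x => inl (inl x)
  | inr p => match t p with inl i => inl (inr i) | inr q => inr q end end.
exists (fun w => sat M phi (fun i => look w (s' i))); split; first by exists n, phi, s'.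
move=> w; rewrite hs.
suff -> : (fun i => look w (s i)) = fun i => look (sumcat w a) (s' i) by [].
apply: funext => i; rewrite /s'; case: (s i) => //= p; rewrite ht.
by case: (t p).
Qed.

Lemma df_rel2 A W (R : M -> M -> Prop) (E F : (W -> M) -> M) :
  df A (fun w : unit + unit -> M => R (w (inl tt)) (w (inr tt))) ->
  vp A E -> vp A F -> df A (fun w => R (E w) (F w)).
Proof.
move=> dR vE vF.
by apply: (df_sub (E := fun i w => match i with inl _ => E w | inr _ => F w end) dR) => // -[].
Qed.

Lemma dclP A y : dcl M A y <-> df A (fun w : unit -> M => w tt = y).
Proof. exact: definable1P. Qed.

Lemma dcl_mono A B y : A `<=` B -> dcl M A y -> dcl M B y.
Proof. by move=> AB /dclP d; apply/dclP; apply: df_mono d. Qed.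

Lemma df_abs1 A W y (Z : (W -> M) -> Prop) : df (A `|` [set y]) Z ->
  exists Y : (W + unit -> M) -> Prop, df A Y /\ forall w, Z w <-> Y (sumcat w (fun=> y)).
Proof. by move/df_abs; apply=> x [|->]; [left|right; exists tt]. Qed.

Lemma dcl_trans A x y : dcl M (A `|` [set x]) y -> dcl M A x -> dcl M A y.
Proof.
move=> /dclP/df_abs1[Y [dY hY]] /dclP dx; apply/dclP.
have hE w : w tt = y <-> exists t, t = x /\ Y (sumcat w (fun=> t)).
  by rewrite hY; split=> [h|[t [-> h]]] //; exists x.
apply: df_ext (fun w => iff_sym (hE w)) _; apply: df_ex; apply: df_and.
  exact: (df_re (fun=> None) dx).
apply: (df_sub (E := fun i w => match i with inl j => w (Some j) | inr _ => w None end) dY) => //.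
  by move=> [i|i]; apply: vp_var.
Qed.

End Abstraction.

(** * Unary definable sets in o-minimal structures *)

Section Order.
Variables (L : oag_language) (N : structure L).
Implicit Types A B X Y : set N.
Local Notation "x <' y" := (@mlt L N x y) (at level 70).

Lemma df_lt A W (E F : (W -> N) -> N) : vp A E -> vp A F -> df A (fun w => E w <' F w).
Proof.
move=> vE vF; rewrite /mlt.
pose G (i : 'I_(rar (lt_sym L))) (w : W -> N) :=
  if nat_of_ord i is 0 then E w else F w.
suff -> : (fun w => rint N (lt_sym L) (tnth [tuple E w; F w] \o cast_ord (lt_ar L))) =
    fun w => rint N (lt_sym L) (fun i => G i w).
  by apply: df_rel => -[[|i] hi].
apply: funext => w; congr rint; apply: funext => i /=; rewrite (tnth_nth (E w)) /= /G.
by move: (ltn_ord i); rewrite [in X in _ < X]lt_ar; case: (nat_of_ord i) => [|[]].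
Qed.

Lemma df_add A W (E F G : (W -> N) -> N) :
  vp A E -> vp A F -> vp A G -> df A (fun w => G w = madd (E w) (F w)).
Proof.
move=> vE vF vG; rewrite /madd.
pose H (i : 'I_(far (add_sym L))) (w : W -> N) :=
  if nat_of_ord i is 0 then E w else F w.
suff -> : (fun w => G w = fint N (add_sym L) (tnth [tuple E w; F w] \o cast_ord (add_ar L))) =
    fun w => G w = fint N (add_sym L) (fun i => H i w).
  by apply: df_fun => // -[[|i] hi].
apply: funext => w; congr (_ = _); congr fint; apply: funext => i /=.
rewrite (tnth_nth (E w)) /= /H.
by move: (ltn_ord i); rewrite [in X in _ < X]add_ar; case: (nat_of_ord i) => [|[]].
Qed.

Hypothesis om : o_minimal N.

Lemma mltxx x : ~ x <' x.
Proof. by have [[h _ _] _ _ _] := om; apply: h. Qed.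

Lemma mlt_trans x y z : x <' y -> y <' z -> x <' z.
Proof. by have [[_ h _] _ _ _] := om; apply: h. Qed.

Lemma mlt_total x y : [\/ x <' y, x = y | y <' x].
Proof. by have [[_ _ h] _ _ _] := om; apply: h. Qed.

Lemma mlt_ub x y : exists z, x <' z /\ y <' z.
Proof.
have [_ _ ne _] := om.
have [h|->|h] := mlt_total x y.
- by have [_ [z yz]] := ne y; exists z; split=> //; apply: mlt_trans yz.
- by have [_ [z yz]] := ne y; exists z.
- by have [_ [z yz]] := ne x; exists z; split=> //; apply: mlt_trans yz.
Qed.

(** O-minimality as an induction principle, so that a fact about all unary definable sets is checked
    on points, intervals and binary unions. The case of [set0] starts the finite unions. *)
Lemma omin_ind (P : set N -> Prop) :
  P set0 -> (forall x, P [set x]) -> (forall a b, P (open_interval a b)) ->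
  (forall X Y, P X -> P Y -> P (X `|` Y)) ->
  forall X, definable1 N setT X -> P X.
Proof.
move=> P0 P1 Pi PU X dX; have [_ _ _ /(_ X dX)[k [l [p [e ->]]]]] := om.
have PB n (F : 'I_n -> set N) : (forall i, P (F i)) -> P (\bigcup_i F i).
  elim: n F => [|n IH] F PF.
    by rewrite (_ : \bigcup_i F i = set0) // -subset0 => x [[]].
  rewrite (_ : \bigcup_i F i = F ord0 `|` \bigcup_i F (lift ord0 i)).
    by apply: PU => //; apply: IH.
  apply/seteqP; split=> x.
    move=> [i _]; case: (unliftP ord0 i) => [j|] ->; last by left.
    by right; exists j.
  by move=> [h|[i _ h]]; [exists ord0|exists (lift ord0 i)].
apply: PU; last exact: PB.
rewrite (_ : range p = \bigcup_i [set p i]); first exact: PB.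
by apply/seteqP; split=> x [i _ h]; exists i.
Qed.

Definition eventual X := exists c, forall x, c <' x -> X x.

Lemma eventual_and X Y : eventual X -> eventual Y -> eventual (X `&` Y).
Proof.
move=> [c hc] [d hd]; have [e [ce de]] := mlt_ub c d.
by exists e => x ex; split; [apply: hc|apply: hd]; apply: mlt_trans ex.
Qed.

Lemma eventual_mono X Y : X `<=` Y -> eventual X -> eventual Y.
Proof. by move=> XY [c h]; exists c => x /h/XY. Qed.

(** Completeness of the type at $+\infty$: an interval without right endpoint contains a final
    segment, the other building blocks miss one, and the dichotomy passes to unions. *)
Lemma eventual_dec X : definable1 N setT X -> eventual X \/ eventual (~` X).
Proof.
have [c0] := carrier_inhabited N.
move: X; apply: omin_ind.
- by right; exists c0 => x _ [].
- by move=> x; right; exists x => y xy /= e; apply: (@mltxx x); rewrite -{2}e.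
- move=> a [b|].
    by right; exists b => x bx [_ xb]; apply: (@mltxx x); apply: mlt_trans bx.
  by left; case: a => [a|]; [exists a|exists c0] => x ax; split.
- move=> X Y [hX|hX] hY; first by left; apply: eventual_mono hX => x; left.
  case: hY => hY; first by left; apply: eventual_mono hY => x; right.
  right; apply: eventual_mono (eventual_and hX hY) => x [nx ny] [|]; done.
Qed.

Definition is_lub X s := (forall x, X x -> x = s \/ x <' s) /\
  forall t, t <' s -> exists2 x, X x & t <' x.

Lemma definable_lub X x0 c : definable1 N setT X ->
  X x0 -> (forall x, X x -> x <' c) -> exists s, is_lub X s.
Proof.
move=> dX Xx0 Xc.
(* The pieces of a nonempty set may be empty, so the hypotheses do not suit an induction on pieces;
   this trichotomy is stable under unions. *)
suff : [\/ X `<=` set0, forall c, exists2 x, X x & c <' x | exists s, is_lub X s].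
  move=> [/(_ _ Xx0)//|/(_ c)[x /Xc xc cx]|//].
  by case: (@mltxx x); apply: mlt_trans cx.
move: X dX {x0 c Xx0 Xc}; apply: omin_ind.
- by apply: Or31.
- move=> x; apply: Or33; exists x; split; first by left.
  by move=> t tx; exists x.
- move=> a b; have [[x0 [ax0 x0b]]|ne] := pselect (open_interval a b !=set0); last first.
    by apply: Or31 => x h; apply: ne; exists x.
  case: b x0b => [b|] x0b; [apply: Or33; exists b|apply: Or32 => c].
    split; first by move=> x [_]; right.
    move=> t tb; have [tx|tx|xt] := mlt_total t x0.
    + by exists x0.
    + have [_ /(_ _ _ x0b)[y [x0y yb]] _ _] := om.
      exists y; last by rewrite tx.
      by split=> //; case: (a) ax0 => // a' ax0; apply: mlt_trans x0y.
    + have [_ /(_ _ _ tb)[y [ty yb]] _ _] := om.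
      exists y => //; split=> //; case: (a) ax0 => // a' ax0.
      by apply: mlt_trans ax0 _; apply: mlt_trans ty.
  have [y [cy x0y]] := mlt_ub c x0; exists y => //; split=> //.
  by case: (a) ax0 => // a' ax0; apply: mlt_trans x0y.
- move=> X Y [X0|Xu|[s [s1 s2]]] hY.
  + have -> : X `|` Y = Y by apply/seteqP; split=> x; [case=> [/X0|]|right].
    by [].
  + by apply: Or32 => c; have [x xx cx] := Xu c; exists x => //; left.
  case: hY => [Y0|Yu|[t [t1 t2]]].
  + have -> : X `|` Y = X by apply/seteqP; split=> x; [case=> [|/Y0]|left].
    by apply: Or33; exists s.
  + by apply: Or32 => c; have [x xx cx] := Yu c; exists x => //; right.
  have [st|st|ts] := mlt_total s t; apply: Or33.
  + exists t; split=> [x [/s1[->|xs]|/t1//]|u /t2[x Yx ux]].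
    * by right.
    * by right; apply: mlt_trans st.
    * by exists x => //; right.
  + exists s; split=> [x [/s1//|]|u /s2[x Xx ux]]; first by rewrite st; apply: t1.
    by exists x => //; left.
  + exists s; split=> [x [/s1//|/t1[->|xt]]|u /s2[x Xx ux]].
    * by right.
    * by right; apply: mlt_trans ts.
    * by exists x => //; left.
Qed.

Lemma finite_or_interval X : definable1 N setT X ->
  finite_set X \/ exists a b, open_interval a b !=set0 /\ open_interval a b `<=` X.
Proof.
move: X; apply: omin_ind.
- by left; apply: finite_set0.
- by move=> x; left; apply: finite_set1.
- move=> a b; have [ne|e] := pselect (open_interval a b !=set0).
    by right; exists a, b; split=> // x.
  left; apply: sub_finite_set (finite_set0 _) => x h; apply: e; by exists x.
- move=> X Y [fX|[a [b [ne s]]]]; last first.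
    by move=> _; right; exists a, b; split=> // x /s; left.
  move=> [fY|[a [b [ne s]]]]; first by left; rewrite finite_setU.
  by right; exists a, b; split=> // x /s; right.
Qed.

End Order.

(** * Exchange in o-minimal structures *)

Lemma finite_set_induction T (P : set T -> Prop) :
  P set0 -> (forall x X, P X -> P ([set x] `|` X)) ->
  forall X, finite_set X -> P X.
Proof.
move=> P0 PU X /(@finite_seqP {classic T})[s ->].
elim: s => [|x s IH].
  by rewrite (_ : [set` _] = set0) // -subset0 => y.
rewrite (_ : [set` _] = [set x] `|` [set` s]); first exact: PU.
apply/seteqP; split=> y; rewrite /= in_cons.
  by move=> /orP[/eqP|]; [left|right].
by move=> [->|->]; rewrite ?eqxx ?orbT.
Qed.

Section Exchange.
Variables (L : oag_language) (N : structure L).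
Implicit Types A B C X Y : set N.
Local Notation "x <' y" := (@mlt L N x y) (at level 70).
Hypothesis om : o_minimal N.
Let mltxx := mltxx om.
Let mlt_trans := mlt_trans om.
Let mlt_total := mlt_total om.

Lemma finite_min_max X x : finite_set X -> X x ->
  (exists2 m, X m & forall y, X y -> ~ y <' m) /\
  (exists2 m, X m & forall y, X y -> ~ m <' y).
Proof.
move=> fX Xx; suff [/(_ _ Xx)|//] : X `<=` set0 \/
  (exists2 m, X m & forall y, X y -> ~ y <' m) /\
  (exists2 m, X m & forall y, X y -> ~ m <' y) by [].
move: X fX {x Xx}; apply: finite_set_induction; first by left.
move=> x X [X0|[[m Xm hm] [m' Xm' hm']]]; right.
  by split; exists x; [left| |left|] => // y [->|/X0//]; apply: mltxx.
split.
  have [xm|e|mx] := mlt_total x m.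
  - exists x; [by left|move=> y [->|/hm h yx]; first exact: mltxx].
    by apply: h; apply: mlt_trans xm.
  - by exists m; [by right|move=> y [->|/hm//]]; rewrite e; apply: mltxx.
  - by exists m; [by right|move=> y [-> xm|/hm//]]; apply: (@mltxx x); apply: mlt_trans mx.
have [xm|e|mx] := mlt_total m' x.
- exists x; [by left|move=> y [->|/hm' h yx]; first exact: mltxx].
  by apply: h; apply: mlt_trans yx.
- by exists m'; [by right|move=> y [->|/hm'//]]; rewrite e; apply: mltxx.
- by exists m'; [by right|move=> y [-> xm|/hm'//]]; apply: (@mltxx x); apply: mlt_trans mx _.
Qed.

(** The order names the points of [C]: the least one outside [dcl] would be either the minimum of
    [C] or the immediate successor in [C] of a point already in [dcl]. *)
Lemma finite_definable_dcl A C x : finite_set C ->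
  df A (fun w : unit -> N => C (w tt)) -> C x -> dcl N A x.
Proof.
move=> fC dC Cx; apply: contrapT => nx.
have [[{Cx nx}x [Cx nx] xmin] _] : _ /\ _ :=
  @finite_min_max [set y | C y /\ ~ dcl N A y] x
    (sub_finite_set (fun y => @proj1 _ _) fC) (conj Cx nx).
have dC' W (E : (W -> N) -> N) : vp A E -> df A (fun w => C (E w)).
  by move=> vE; apply: (df_sub (E := fun _ => E) dC).
have dC'' B W (E : (W -> N) -> N) : A `<=` B -> vp B E -> df B (fun w => C (E w)).
  by move=> AB vE; apply: (df_sub (E := fun _ => E) dC).
have [[y [Cy yx]]|ny] := pselect (exists y, C y /\ y <' x); last first.
  apply: nx; apply/dclP.
  have h (w : unit -> N) : C (w tt) /\ (forall z, C z -> ~ z <' w tt) <-> w tt = x.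
    split=> [[Cw wm]|->]; last by split=> // z Cz zx; apply: ny; exists z.
    have [wx|//|xw] := mlt_total (w tt) x; first by case: ny; exists (w tt).
    by case: (wm x Cx).
  apply: df_ext h _; apply: df_and => //.
  apply: df_all; apply: df_imp; first by apply: dC'; apply: vp_var.
  by apply: df_not; apply: df_lt; apply: vp_var.
have [_ [{Cy yx}y [Cy yx] ymax]] : _ /\ _ :=
  @finite_min_max [set y | C y /\ y <' x] y
    (sub_finite_set (fun y => @proj1 _ _) fC) (conj Cy yx).
apply: nx; apply: (@dcl_trans _ _ A y); last first.
  by apply: contrapT => ny; apply: (xmin y).
apply/dclP.
have h (w : unit -> N) : (C (w tt) /\ y <' w tt) /\
    (forall z, C z /\ z <' w tt -> ~ y <' z) <-> w tt = x.
  split=> [[[Cw yw] wm]|->].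
    have [wx|//|xw] := mlt_total (w tt) x; first by case: (ymax (w tt)).
    by case: (wm x).
  by split=> // z [Cz zx] yz; case: (ymax z).
have Ay : (A `|` [set y]) y by right.
have sA : A `<=` A `|` [set y] by left.
apply: df_ext h _; apply: df_and.
  apply: df_and; first by apply: dC'' => //; apply: vp_var.
  by apply: df_lt; [apply: vp_par|apply: vp_var].
apply: df_all; apply: df_imp.
  apply: df_and; first by apply: dC'' => //; apply: vp_var.
  by apply: df_lt; apply: vp_var.
by apply: df_not; apply: df_lt; [apply: vp_par|apply: vp_var].
Qed.

(* [G] is constant on each of the finitely many intervals making up [D]. *)
Lemma locally_constant_finite (G : N -> N -> Prop) (D : set N) :
  df setT (fun w : unit + unit -> N => G (w (inl tt)) (w (inr tt))) ->
  definable1 N setT D ->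
  (forall z z' t, G z t -> G z' t -> z = z') ->
  (forall t, D t -> exists z l r, [/\ l <' t, t <' r &
     forall t', l <' t' -> t' <' r -> G z t']) ->
  finite_set [set z | exists2 t, D t & G z t].
Proof.
move=> dG dD Gf loc.
have const t1 t2 z : t1 <' t2 -> (forall t, ~ t <' t1 -> ~ t2 <' t -> D t) ->
    G z t1 -> G z t2.
  move=> t12 sD Gz1.
  (* A connectedness argument: [S] collects the points of $[t_1,t_2]$ up to which the value is [z],
     and local constancy at its supremum carries the value beyond it unless $t_2$ is already
     covered. *)
  pose S t := [/\ ~ t <' t1, ~ t2 <' t & forall t', ~ t' <' t1 -> ~ t <' t' -> G z t'].
  have S1 : S t1.
    split; [exact: mltxx|by move=> h; apply: (@mltxx t1); apply: mlt_trans h|].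
    by move=> t'; have [||] := mlt_total t' t1 => // ->.
  have [_ _ /(_ t2)[_ [c tc]] _] := om.
  have [|t [_ h _]|s [s1 s2]] := @definable_lub _ _ om S t1 c _ S1.
  - apply/definable1P.
    apply: (@df_ext _ _ _ _ (fun w : unit -> N => (~ w tt <' t1 /\ ~ t2 <' w tt) /\
      forall t', ~ t' <' t1 -> ~ w tt <' t' -> G z t')).
      by move=> w; split=> [[[]]|[]].
    apply: df_and.
      by apply: df_and; apply: df_not; apply: df_lt; solve_vp.
    apply: df_all; apply: df_imp; first by apply: df_not; apply: df_lt; solve_vp.
    apply: df_imp; first by apply: df_not; apply: df_lt; solve_vp.
    by apply: df_rel2 => //; solve_vp.
  - by have [|->|/h] := mlt_total t t2 => // /mlt_trans; apply.
  have s1t : ~ s <' t1 by move=> h; case: (s1 _ S1) h => [->|h /mlt_trans/(_ h)]; apply: mltxx.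
  have st2 : ~ t2 <' s by move=> /s2[x [_ h _]].
  have [z' [l [r [ls sr Gz']]]] := loc s (sD s s1t st2).
  have [t St lt] := s2 l ls.
  have ts : ~ s <' t by case: (s1 t St) => [->|h /mlt_trans/(_ h)]; apply: mltxx.
  have tr : t <' r by have [h|->|//] := mlt_total t s; [apply: mlt_trans sr|].
  have Gzt : G z t by case: St => h1 h2; apply => //; apply: mltxx.
  have ezz : z' = z by apply: Gf (Gz' t lt tr) Gzt.
  subst z'.
  have upto t' : ~ t' <' t1 -> t' <' r -> G z t'.
    move=> h1 h2; have [h|h|h] := mlt_total t' t.
    + by case: St => _ _; apply => // h'; apply: (@mltxx t); apply: mlt_trans h' _.
    + by apply: Gz' => //; rewrite h.
    + by apply: Gz' => //; apply: mlt_trans h.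
  have [h|h] := pselect (t2 <' r).
    by apply: upto => // h'; apply: (@mltxx t1); apply: mlt_trans h'.
  have [_ /(_ _ _ sr)[u [su ur]] _ _] := om.
  have Su : S u.
    split.
    - by move=> h'; apply: s1t; apply: mlt_trans h'.
    - by move=> h'; apply: h; apply: mlt_trans ur.
    - move=> t' a b; apply: upto => //.
      by have [h'|->|] := mlt_total t' u => //; apply: mlt_trans ur.
  by case: (@mltxx s); case: (s1 u Su) => [e|us]; [rewrite -{2}e|apply: mlt_trans us].
have fin1 X : (forall z z' t t', X t -> X t' -> G z t -> G z' t' -> z = z') ->
    finite_set [set z | exists2 t, X t & G z t].
  move=> h; have [[z0 [t0 X0 G0]]|ne] := pselect (exists z, exists2 t, X t & G z t).
    by apply: sub_finite_set (finite_set1 z0) => z [t Xt Gz]; apply: h Xt X0 Gz G0.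
  by apply: sub_finite_set (finite_set0 _) => z h'; apply: ne; exists z.
suff /(_ D dD) : forall E, definable1 N setT E ->
  E `<=` D -> finite_set [set z | exists2 t, E t & G z t] by apply.
apply: omin_ind => //.
- by move=> _; apply: fin1.
- by move=> x _; apply: fin1 => z z' t t' -> ->; apply: Gf.
- move=> a b sD; apply: fin1.
  have key t t' : open_interval a b t -> open_interval a b t' -> t <' t' ->
      forall z z', G z t -> G z' t' -> z = z'.
    move=> [at1 _] [_ bt'] tt' z z' Gz; apply: (Gf _ _ t'); apply: const Gz => // u ut tu.
    apply: sD; split.
      case: (a) at1 => // a' h; have [h'|<-|h'] := mlt_total t u => //.
      exact: mlt_trans h'.
    case: (b) bt' => // b' h; have [h'|<-|h'] := mlt_total t' u => //.
    exact: mlt_trans h.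
  move=> z z' t t' ht ht' Gz Gz'; have [h|h|h] := mlt_total t t'.
  + exact: key h _ _ Gz Gz'.
  + by subst; apply: Gf Gz Gz'.
  + by apply/esym; apply: key h _ _ Gz' Gz.
- move=> X Y hX hY sD.
  have -> : [set z | exists2 t, (X `|` Y) t & G z t] =
     [set z | exists2 t, X t & G z t] `|` [set z | exists2 t, Y t & G z t].
    apply/seteqP; split=> z; first by move=> [t [h|h] g]; [left|right]; exists t.
    by move=> [[t h g]|[t h g]]; exists t => //; [left|right].
  by rewrite finite_setU; split; [apply: hX|apply: hY] => t h; apply: sD; [left|right].
Qed.

(** Write $x=g(y)$ with [g] a partial function definable over [A]. Where [g] is locally constant it
    has finitely many values, all in [dcl] of [A]; hence [y] lies elsewhere. There the fibre of [g]
    over [x] contains no interval, so it is finite, and its points are in [dcl] of [A] and [x]. This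
    avoids the monotonicity theorem. *)
Lemma dcl_exchange A x y :
  dcl N (A `|` [set y]) x -> ~ dcl N A x -> dcl N (A `|` [set x]) y.
Proof.
move=> /dclP/df_abs1[Y [dY hY]] nx.
pose R z t := Y (sumcat (fun _ : unit => z) (fun _ : unit => t)).
have dR B W (E F : (W -> N) -> N) : A `<=` B -> vp B E -> vp B F -> df B (fun w => R (E w) (F w)).
  move=> AB vE vF.
  by apply: (df_sub (E := fun i w => match i with inl _ => E w | inr _ => F w end) dY) => // -[].
have Ry z : R z y <-> z = x by exact: (iff_sym (hY (fun=> z))).
(* The graph of [g]: [R] restricted to those [t] that have exactly one value. [D] is the set where
   [g] is locally constant and [C] the set of its values there. *)
pose G z t := R z t /\ forall z', R z' t -> z' = z.
have dG B W (E F : (W -> N) -> N) : A `<=` B -> vp B E -> vp B F -> df B (fun w => G (E w) (F w)).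
  move=> AB [s hs] [t ht].
  have -> : (fun w => G (E w) (F w)) = fun w => G (look w s) (look w t).
    by apply: funext => w; rewrite hs ht.
  apply: df_and; first by apply: dR => //; [exists s|exists t].
  apply: df_all; apply: df_imp.
    apply: dR => //; first by solve_vp.
    by case: t {ht} => t; [exists (inl (Some t))|exists (inr t)].
  apply: df_eq; first by solve_vp.
  by case: s {hs} => s; [exists (inl (Some s))|exists (inr s)].
have Gf z z' t : G z t -> G z' t -> z = z' by move=> [_ h] [/h].
have Gxy : G x y by split; [apply/Ry|move=> z' /Ry].
pose D t := exists z l r, (l <' t /\ t <' r) /\ forall t', l <' t' -> t' <' r -> G z t'.
have dD B : A `<=` B -> df B (fun w : unit -> N => D (w tt)).
  move=> AB; do 3 apply: df_ex; apply: df_and.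
    by apply: df_and; apply: df_lt; solve_vp.
  apply: df_all; apply: df_imp; first by apply: df_lt; solve_vp.
  by apply: df_imp; [apply: df_lt; solve_vp|apply: dG => //; solve_vp].
pose C z := exists t, D t /\ G z t.
have dC : df A (fun w : unit -> N => C (w tt)).
  apply: df_ex; apply: df_and; first exact: (df_re (fun=> None) (dD A (@subset_refl _ _))).
  by apply: dG => //; solve_vp.
have fC : finite_set C.
  rewrite (_ : C = [set z | exists2 t, D t & G z t]); last first.
    by apply/seteqP; split=> z; [move=> [t [? ?]]|move=> [t]]; exists t.
  apply: locally_constant_finite.
  - by apply: dG => //; solve_vp.
  - by apply/definable1P; apply: dD.
  - exact: Gf.
  - by move=> t [z [l [r [[lt tr] h]]]]; exists z, l, r.
have nD : ~ D y by move=> Dy; apply: nx; apply: (finite_definable_dcl fC dC); exists y.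
have dF B : A `|` [set x] `<=` B -> df B (fun w : unit -> N => G x (w tt) /\ ~ D (w tt)).
  move=> AB; apply: df_and; first apply: dG; try by [move=> a Aa; apply: AB; left|solve_vp].
    by apply: vp_par; apply: AB; right.
  by apply: df_not; apply: dD => a Aa; apply: AB; left.
have := @finite_or_interval _ _ om [set t | G x t /\ ~ D t].
case; first by apply/definable1P; apply: dF.
  by move=> fF; apply: (@finite_definable_dcl _ [set t | G x t /\ ~ D t]) => //; apply: dF.
move=> [a [b [[t [at1 tb]] s]]].
have [_ []] : G x t /\ ~ D t by apply: s.
have [_ dens ne _] := om.
(* [D] asks for endpoints in the structure, so an infinite end of the interval is replaced by a
   point beyond [t]. *)
have [l [lt sl]] : exists l, l <' t /\ forall u, l <' u -> if a is Some a' then a' <' u else True.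
  case: (a) at1 => [a'|] h; first by exists a'.
  by have [[l lt] _] := ne t; exists l.
have [r [tr sr]] : exists r, t <' r /\ forall u, u <' r -> if b is Some b' then u <' b' else True.
  case: (b) tb => [b'|] h; first by exists b'.
  by have [_ [r tr]] := ne t; exists r.
exists x, l, r; split=> // u lu ur.
by have [] : G x u /\ ~ D u by apply: s; split; [apply: sl|apply: sr].
Qed.

End Exchange.

(** * Saturation and small sets *)

Section Reduct.
Variables (L : language) (M : structure (langU L)).

Lemma sat_formulaU n (phi : formula L n) (v : 'I_n -> M) :
  sat M (formulaU phi) v <-> sat (reduct M) phi v.
Proof.
have ev m (w : 'I_m -> M) t : eval (M := M) w (termU t) = eval (M := reduct M) w t.
  by elim: t => //= f ts IH; congr fint; apply: funext => j.
elim: phi v => {n} [n|n s t|n q ts|n phi IH psi IH'|n phi IH] v //=.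
- by rewrite !ev.
- suff -> : (fun j => eval (M := M) v (termU (ts j))) =
    fun j => eval (M := reduct M) v (ts j) by [].
  by apply: funext => j; rewrite ev.
- by rewrite IH IH'.
- by split=> H x; move: (H x); rewrite IH.
Qed.

Lemma df_reduct (A : set M) W (Z : (W -> M) -> Prop) :
  df (M := reduct M) A Z -> df A Z.
Proof.
by move=> [n [phi [s hs]]]; exists n, (formulaU phi), s => w; rewrite hs sat_formulaU.
Qed.

Lemma df_Uset (A : set M) W (E : (W -> M) -> M) : vp A E -> df A (fun w => Uset M (E w)).
Proof. by move=> vE; apply: (@df_rel _ M A W None (fun _ => E)). Qed.

End Reduct.

Section Saturation.
Variables (K : Type) (L : language) (M : structure L).

Lemma finite_card_lt (L' : language) S (A : set S) :
  card_lt K [set: Defs.fsym L' + Defs.rsym L' + nat] -> finite_set A -> card_lt K A.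
Proof.
move=> [h1 h2] /finite_set_countable cA.
have cn : card_le [set: nat] [set: Defs.fsym L' + Defs.rsym L' + nat].
  pose g (x : Defs.fsym L' + Defs.rsym L' + nat) := if x is inr n then n else 0.
  rewrite (_ : [set: nat] = g @` setT); first exact: card_image_le.
  by apply/seteqP; split=> // n _; exists (inr n).
split; first exact: card_le_trans cA (card_le_trans cn h1).
by move=> h; apply: h2; apply: card_le_trans h (card_le_trans cA cn).
Qed.

Hypothesis satM : saturated K M.

(** [F] may contain arbitrary sets, so that consistency is just closure under intersection and
    nonemptiness; definability over [A] is asked only of the members to be realized. *)
Lemma saturation_filter (A : set M) (F : set (set M)) : card_lt K A ->
  F setT -> (forall X Y, F X -> F Y -> F (X `&` Y)) -> (forall X, F X -> X !=set0) ->
  exists x, forall X, F X -> df A (fun w : unit -> M => X (w tt)) -> X x.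
Proof.
move=> sA FT FI Fne.
have [q qp fq|x hx] := @satM A sA 1 [set phi | F [set x | psat phi (fun=> x)]].
  suff [X FX hX] : exists2 X, F X & forall phi x, q phi -> X x -> psat phi (fun=> x).
    by have [x Xx] := Fne X FX; exists (fun=> x) => phi qphi; apply: hX.
  move: q fq qp; apply: finite_set_induction; first by exists setT.
  move=> phi q IH hq; have [psi h|X FX hX] := IH; first by apply: hq; right.
  exists (X `&` [set x | psat phi (fun=> x)]); first by apply: FI => //; apply: hq; left.
  by move=> psi x [->|qpsi] [Xx px] //; apply: hX.
exists (x ord0) => X FX /definable1P[phi hphi].
have e y : X (y ord0) = psat phi y by apply: (congr1 (fun S => S y) hphi).
rewrite e; apply: hx; rewrite /= (_ : [set _ | _] = X) //.
by apply/seteqP; split=> z /=; rewrite -(e (fun=> z)).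
Qed.

Lemma history_recursion S (P : seq S -> S -> Prop) :
  (forall s, exists x, P s x) -> exists h, forall n, P (mkseq h n) (h n).
Proof.
move=> /choice[f hf]; pose g := fix g n := if n is m.+1 then rcons (g m) (f (g m)) else [::].
have gE n : g n = mkseq (fun n => f (g n)) n.
  by elim: n => // n IH; rewrite mkseqS -IH.
by exists (fun n => f (g n)) => n; rewrite -gE.
Qed.

(** Saturation handles finite tuples, so the sequence is built entry by entry, keeping each
    definable member of [F] satisfiable by some continuation of the initial segment. Such a member
    reads finitely many entries, hence a long enough segment decides it. *)
Lemma realize_sequence_type (F : set (set (nat -> M))) :
  (forall A : set M, finite_set A -> card_lt K A) ->
  F setT -> (forall X Y, F X -> F Y -> F (X `&` Y)) -> (forall X, F X -> X !=set0) ->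
  exists a, forall X, F X -> df set0 X -> X a.
Proof.
move=> small FT FI Fne; have [x0] := carrier_inhabited M.
pose ext (s : seq M) (w : nat -> M) i := if i < size s then nth x0 s i else w i.
pose good s := forall X, F X -> df set0 X -> exists w, X (ext s w).
have ext_rcons s x w : ext (rcons s x) w = ext s (fun i => if i == size s then x else w i).
  apply: funext => i; rewrite /ext size_rcons nth_rcons ltnS.
  by case: (ltngtP i (size s)).
have [s|a ha] := @history_recursion M (fun s x => good s -> good (rcons s x)).
  have [gs|] := pselect (good s); last by exists x0.
  pose A := range (fun i : 'I_(size s) => nth x0 s i).
  pose F' Y := exists X, [/\ F X, df set0 X &
    forall x, (exists w, X (ext (rcons s x) w)) -> Y x].
  have [||Y Y' [X [FX dX hX]] [X' [FX' dX' hX']]|Y [X [FX dX hX]]|x hx] :=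
      @saturation_filter A F'.
  - by apply: small; apply: finite_image; apply: finite_finset.
  - by exists setT; split=> //; apply: df_ext (df_not (@df_bot _ M set0 nat)) => w; split=> // _ [].
  - exists (X `&` X'); split; [exact: FI|exact: df_and|].
    by move=> x [w [h h']]; split; [apply: hX|apply: hX']; exists w.
  - have [w hw] := gs X FX dX; exists (w (size s)); apply: hX; exists w.
    rewrite ext_rcons; suff -> : (fun i => if i == size s then w (size s) else w i) = w by [].
    by apply: funext => i; case: eqP => // ->.
  exists x => _ X FX dX; apply: (hx (fun x => exists w, X (ext (rcons s x) w))).
    by exists X.
  pose E i (w : unit + nat -> M) := if i < size s then nth x0 s i else
    if i == size s then w (inl tt) else w (inr i).
  have dE : df A (fun w : unit + nat -> M => X (fun i => E i w)).
    apply: (df_sub (E := E) dX); first exact: sub0set.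
    move=> i; rewrite /E; case h: (i < size s); last by case: (i == size s); apply: vp_var.
    by apply: vp_par; exists (Ordinal h).
  apply: df_ext (df_exs dE) => w.
  have e u : X (ext (rcons s (w tt)) u) = X (fun i => E i (sumcat w u)).
    by congr X; rewrite ext_rcons.
  by split=> -[u h]; exists u; [rewrite e|rewrite -e].
have ga n : good (mkseq a n).
  elim: n => [X FX _|n IH]; last by rewrite mkseqS; apply: ha.
  by have [w Xw] := Fne X FX; exists w.
exists a => X FX dX; have [n [s hs]] := df_finite_support dX.
have [w hw] := ga (\max_(i < n) (s i).+1) X FX dX.
apply: hs hw => i; rewrite /ext size_mkseq.
have h : s i < \max_(i < n) (s i).+1 by apply: (@leq_bigmax _ (fun i => (s i).+1)).
by rewrite h nth_mkseq.
Qed.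

End Saturation.

(** * Images of powers of [U] *)

Section Thin.
Variables (L : oag_language) (N : structure L) (U : set N).
Implicit Types S : set N.

(* [f] is total so that it can be fed to [small_set]. *)
Definition thin S := exists (V : finType) (f : (V -> N) -> N),
  df setT (fun w : option V -> N => w None = f (fun i => w (Some i))) /\
  forall y, S y -> exists u, (forall i, U (u i)) /\ f u = y.

Lemma thin_interval S a b : small_set N U -> thin S -> open_interval a b !=set0 ->
  ~ open_interval a b `<=` S.
Proof.
move=> sU [V [f [df hf]]] ne sS; apply: sU.
exists #|V|, (fun v => f (fun x => v (enum_rank x))), a, b; split=> //.
  apply/definableP; exact: (df_re (fun o : option V =>
    if o is Some x then lift ord0 (enum_rank x) else ord0) df).
move=> y /sS/hf[u [Uu <-]]; exists (fun i => u (enum_val i)); first by move=> i.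
by congr f; apply: funext => x; rewrite enum_rankK.
Qed.

(** Applied to the points that one fixed formula puts into [dcl] of [U] and fixed parameters. The
    partial function giving the unique solution is made total with the constant value [x0], which is
    allowed as a parameter. *)
Lemma thin_image (V : finType) (Y : (option V -> N) -> Prop) : df setT Y ->
  thin [set y | exists u, (forall i, U (u i)) /\ forall z, Y (ocons z u) <-> z = y].
Proof.
move=> dY; have [x0] := carrier_inhabited N.
have /choice[f hf] : forall u : V -> N, exists y, (forall z, Y (ocons z u) <-> z = y) \/
    (~ exists y, forall z, Y (ocons z u) <-> z = y) /\ y = x0.
  move=> u; have [[y hy]|n] := pselect (exists y, forall z, Y (ocons z u) <-> z = y).
    by exists y; left.
  by exists x0; right.
have fE y u : y = f u <-> (forall z, Y (ocons z u) <-> z = y) \/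
    (~ exists y, forall z, Y (ocons z u) <-> z = y) /\ y = x0.
  split=> [->|]; first exact: hf.
  move=> [h|[n ->]]; case: (hf u) => [h'|[n' e]] //.
  - by apply/h'/h.
  - by case: n'; exists y.
  - by case: n; exists (f u).
exists V, f; split; last first.
  by move=> y [u [Uu h]]; exists u; split=> //; apply/esym/fE; left.
have dG W (E : (W -> N) -> N) (F : V -> (W -> N) -> N) : vp setT E -> (forall i, vp setT (F i)) ->
    df setT (fun w => forall z, Y (ocons z (fun i => F i w)) <-> z = E w).
  move=> [s hs] /choice[t ht].
  have -> : (fun w => forall z, Y (ocons z (fun i => F i w)) <-> z = E w) =
            (fun w => forall z, Y (ocons z (fun i => look w (t i))) <-> z = look w s).
    apply: funext => w; rewrite hs.
    by rewrite (_ : (fun i => F i w) = fun i => look w (t i)) //; apply: funext.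
  have lift (q : W + {x | setT x}) :
      vp setT (fun w : option W -> N => look (fun i => w (Some i)) q).
    by case: q => q; [exists (inl (Some q))|exists (inr q)].
  apply: df_all; apply: df_iff; last by apply: df_eq; [apply: vp_var|apply: lift].
  have := @df_sub _ _ setT setT _ (option W) Y (fun o w => if o is Some i then
    look (fun i => w (Some i)) (t i) else w None) dY (@subset_refl _ _).
  have -> : (fun w : option W -> N => Y (fun o => if o is Some i then
      look (fun i => w (Some i)) (t i) else w None)) =
    (fun w => Y (ocons (w None) (fun i => look (fun i => w (Some i)) (t i)))) by [].
  by apply => -[i|]; [apply: lift|apply: vp_var].
apply: df_ext (fun w => iff_sym (fE (w None) (fun i => w (Some i)))) _.
apply: df_or; first by apply: dG => [|i]; apply: vp_var.
apply: df_and; last by apply: df_eq; solve_vp.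
by apply: df_not; apply: df_ex; apply: dG => [|i]; apply: vp_var.
Qed.

(** One function covers both sets by means of two extra arguments, whose equality selects [f] and
    whose difference selects [f']. The points [p] and [q] realize both cases inside [U], and [p]
    also fills the idle arguments. *)
Lemma thinU S S' p q : U p -> U q -> p <> q -> thin S -> thin S' -> thin (S `|` S').
Proof.
move=> Up Uq pq [V [f [df hf]]] [V' [f' [df' hf']]].
exists (bool + (V + V'))%type, (fun v => if pselect (v (inl true) = v (inl false))
  then f (fun i => v (inr (inl i))) else f' (fun i => v (inr (inr i)))); split; last first.
  move=> y [/hf[u [Uu <-]]|/hf'[u [Uu <-]]].
    exists (sumcat (fun=> p) (sumcat u (fun=> p))); split; first by move=> [|[]].
    by case: pselect.
  exists (sumcat (fun b => if b then p else q) (sumcat (fun=> p) u)); split.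
    by move=> [[]|[]].
  by case: pselect.
pose c b : option (bool + (V + V')) := Some (inl b).
apply: (@df_ext _ _ _ _ (fun w : option (bool + (V + V')) -> N =>
  (w (c true) = w (c false) /\ w None = f (fun i => w (Some (inr (inl i))))) \/
  (~ w (c true) = w (c false) /\ w None = f' (fun i => w (Some (inr (inr i))))))).
  move=> w; case: pselect => h; first by split=> [[[_ //]|[/(_ h)//]]|hA]; left.
  by split=> [[[/h//]|[_ //]]|hB]; right.
apply: df_or; apply: df_and.
- by apply: df_eq; apply: vp_var.
- exact: (df_re (omap (fun i => inr (inl i))) df).
- by apply: df_not; apply: df_eq; apply: vp_var.
- exact: (df_re (omap (fun i => inr (inr i))) df').
Qed.

End Thin.

(** * The generic sequence *)

Lemma df_forall_ord (L : language) (M : structure L) (A : set M) W n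
    (Z : 'I_n -> (W -> M) -> Prop) :
  (forall i, df A (Z i)) -> df A (fun w => forall i, Z i w).
Proof.
elim: n Z => [|n IH] Z dZ.
  by apply: df_ext (df_not (@df_bot _ M A W)) => w; split=> // _ [].
apply: df_ext (df_and (dZ ord0) (IH _ (fun i => dZ (lift ord0 i)))) => w.
split=> [[z0 zl] i|h]; last by split.
by case: (unliftP ord0 i) => [j|] ->.
Qed.

Section GenericSequence.
Variables (K : Type) (L : oag_language) (M : structure (langU L)).
Local Notation N := (reduct M).
Local Notation U := (Uset M).
Local Notation "x <' y" := (@mlt L N x y) (at level 70).
Hypothesis om : o_minimal N.
Hypothesis og : ordered_abelian_group N.
Hypothesis small : forall A : set M, finite_set A -> card_lt K A.
Hypothesis satM : saturated K M.
Hypothesis sU : small_set N U.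
Hypothesis dU : order_dense N U.

Definition dcl_witness I m (Y : (unit + I + 'I_m -> M) -> Prop) (w : unit + I -> M) :=
  exists u : 'I_m -> M, (forall i, U (u i)) /\
    forall z, Y (sumcat (sumcat (fun=> z) (fun i => w (inr i))) u) <-> z = w (inl tt).

Lemma df_dcl_witness I m (Y : (unit + I + 'I_m -> M) -> Prop) :
  df (M := N) set0 Y -> df set0 (dcl_witness Y).
Proof.
move=> /df_reduct dY.
apply: (@df_ex_ord _ M set0 (unit + I) m (fun w => (forall i, U (w (inr i))) /\
    forall z, Y (sumcat (sumcat (fun=> z) (fun i => w (inl (inr i)))) (fun i => w (inr i)))
      <-> z = w (inl (inl tt)))).
apply: df_and.
  by apply: df_forall_ord => i; apply: df_Uset; apply: vp_var.
apply: df_all; apply: df_iff; last by apply: df_eq; apply: vp_var.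
apply: (df_sub (E := fun i w => match i with
  | inl (inl _) => w None | inl (inr i) => w (Some (inl (inr i)))
  | inr j => w (Some (inr j)) end) dY) => //.
by move=> [[?|?]|?]; apply: vp_var.
Qed.

(* Relative to [U], [dcl] is a union of sets definable in the pair without
   parameters, the elements of [U] being quantified over. *)
Lemma dcl_witnessP I (w : unit + I -> M) :
  dcl N (U `|` range (fun i => w (inr i))) (w (inl tt)) <->
  exists m (Y : (unit + I + 'I_m -> M) -> Prop), df (M := N) set0 Y /\ dcl_witness Y w.
Proof.
split=> [/dclP d|[m [Y [dY [u [Uu hY]]]]]].
  have [|Y [dY hY]] := @df_abs _ N U _ unit I (fun i => w (inr i)) _ d.
    by move=> x [Ux|[i _ <-]]; [left|right; exists i].
  have [m [p [Y' [Up dY' hY']]]] := df_finite_params dY.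
  exists m, Y'; split=> //; exists p; split=> // z.
  by rewrite -hY' -(hY (fun=> z)).
apply/dclP; apply: (@df_ext _ N _ unit (fun v => Y (sumcat (sumcat v (fun i => w (inr i))) u))).
  move=> v; rewrite -hY (_ : v = fun=> v tt) //.
  by apply: funext => -[].
apply: (df_sub (M := N) (E := fun i (v : unit -> N) => match i with
  | inl (inl x) => v x | inl (inr i) => w (inr i) | inr j => u j end) dY) => //.
move=> [[?|i]|j]; first exact: vp_var.
  by apply: vp_par; right; exists i.
by apply: vp_par; left; apply: Uu.
Qed.

(** [big] and [big_coset b] are the filters of conditions imposed on the even-numbered and the
    odd-numbered terms. Both contain every set that includes a final segment, which forces each term
    above [dcl] of its predecessors. *)
Definition big (X : set M) := exists c S, thin (N := N) U S /\
  forall x, c <' x -> ~ S x -> X x.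

Definition big_coset b (X : set M) := exists c, forall x, c <' x ->
  (exists u, U u /\ x = madd (M := N) b u) -> X x.

Lemma thin0 : thin (N := N) U set0.
Proof.
exists unit, (fun v => v tt); split=> //.
by apply: df_eq; apply: vp_var.
Qed.

Lemma U_two : exists p q, [/\ U p, U q & p <> q].
Proof.
have [x0] := carrier_inhabited M.
have [|p [_ Up]] := @dU None None; first by exists x0.
have [_ _ /(_ p)[_ [z pz]] _] := om.
have [|q [[pq _] Uq]] := @dU (Some p) None; first by exists z.
by exists p, q; split=> // e; apply: (mltxx om (x := p)); rewrite {2}e.
Qed.

Lemma bigI X Y : big X -> big Y -> big (X `&` Y).
Proof.
move=> [c [S [tS hS]]] [d [S' [tS' hS']]].
have [e [ce de]] := mlt_ub om c d; have [p [q [Up Uq pq]]] := U_two.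
exists e, (S `|` S'); split; first exact: (thinU Up Uq).
move=> x ex nS; split; [apply: hS|apply: hS'];
  by [apply: (mlt_trans om) ex|move=> h; apply: nS; left|move=> h; apply: nS; right].
Qed.

Lemma big_nonempty X : big X -> X !=set0.
Proof.
move=> [c [S [tS hS]]]; apply: contrapT => nX.
have [_ _ /(_ c)[_ [d cd]] _] := om.
apply: (@thin_interval _ _ _ S (Some c) None sU tS); first by exists d.
by move=> x [cx _]; apply: contrapT => nS; apply: nX; exists x; apply: hS.
Qed.

Lemma big_cosetI b X Y : big_coset b X -> big_coset b Y -> big_coset b (X `&` Y).
Proof.
move=> [c hc] [d hd]; have [e [ce de]] := mlt_ub om c d.
by exists e => x ex hx; split; [apply: hc|apply: hd] => //; apply: (mlt_trans om) ex.
Qed.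

Lemma big_coset_nonempty b X : big_coset b X -> X !=set0.
Proof.
move=> [c hc]; have [[addA addC add0 /(_ b)[b' b'b]] [_ addlt]] := og.
(* The element [u] of [U] is taken above $c-b$, so that translating it by [b] brings it above
   [c]. *)
have [_ _ /(_ (madd (M := N) b' c))[_ [z cz]] _] := om.
have [|u [[cu _] Uu]] := @dU (Some (madd (M := N) b' c)) None; first by exists z.
exists (madd (M := N) b u); apply: hc; last by exists u.
move: cu => /(addlt _ _ b); by rewrite addA (addC b) b'b add0.
Qed.

Lemma eventual_big X : eventual (N := N) X -> big X.
Proof. by move=> [c hc]; exists c, set0; split; [exact: thin0|move=> x /hc]. Qed.

Lemma eventual_big_coset b X : eventual (N := N) X -> big_coset b X.
Proof. by move=> [c hc]; exists c => x /hc. Qed.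

Lemma generic_sequence : exists h : nat -> M, forall n X,
  (if odd n then big_coset (h 0) X else big X) ->
  df [set h i | i in [set i | i < n]] (fun w : unit -> M => X (w tt)) -> X (h n).
Proof.
have [x0] := carrier_inhabited M.
(* An odd size means a nonempty history, and its entry 0 is then [h 0]; the default [x0] is never
   read in this case. *)
have [s|h hh] := @history_recursion M (fun s x => forall X,
   (if odd (size s) then big_coset (nth x0 s 0) X else big X) ->
   df [set nth x0 s i | i in [set i | i < size s]] (fun w : unit -> M => X (w tt)) -> X x).
  have eT : eventual (N := N) setT by exists x0.
  apply: (@saturation_filter K _ M satM _
    (fun X => if odd (size s) then big_coset (nth x0 s 0) X else big X)).
  - by apply: small; apply: finite_image; apply: finite_II.
  - by case: odd; [apply: eventual_big_coset|apply: eventual_big].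
  - by move=> X Y; case: odd; [apply: big_cosetI|apply: bigI].
  - by move=> X; case: odd; [apply: big_coset_nonempty|apply: big_nonempty].
exists h => n X hX dX; apply: hh; rewrite size_mkseq.
  by case: n hX {dX} => //= n; rewrite nth_mkseq.
rewrite (_ : [set _ | _ in _] = [set h i | i in [set i | i < n]]) //.
by apply/seteqP; split=> x [i /= hi <-]; exists i => //; rewrite nth_mkseq.
Qed.

Section Properties.
Variable h : nat -> M.
Hypothesis hh : forall n X,
  (if odd n then big_coset (h 0) X else big X) ->
  df [set h i | i in [set i | i < n]] (fun w : unit -> M => X (w tt)) -> X (h n).

(** The last term of an increasing tuple realizes the type at $+\infty$ over the earlier ones. Hence
    [Z] holds at the tuple exactly when it holds at the shortened tuple for all sufficiently large
    last entries, which is a definable condition in one variable less. *)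
Lemma generic_indiscernible k (Z : ('I_k -> N) -> Prop) (s t : 'I_k -> nat) :
  df set0 Z -> (forall i j : 'I_k, i < j -> s i < s j) ->
  (forall i j : 'I_k, i < j -> t i < t j) -> Z (h \o s) <-> Z (h \o t).
Proof.
elim: k Z s t => [|k IH] Z s t dZ hs ht.
  by rewrite (_ : h \o s = h \o t) //; apply: funext => -[].
pose snoc (w : 'I_k -> N) x (i : 'I_k.+1) := if unlift ord_max i is Some j then w j else x.
pose Z' (w : 'I_k -> N) := eventual (fun x => Z (snoc w x)).
have dZ' : df set0 Z'.
  apply: df_ex; apply: df_all; apply: df_imp; first by apply: df_lt; apply: vp_var.
  apply: (df_sub (E := fun i (w : option (option 'I_k) -> N) =>
    if unlift ord_max i is Some j then w (Some (Some j)) else w None) dZ) => //.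
  by move=> i; case: unlift => [j|]; apply: vp_var.
have lmax (r : 'I_k.+1 -> nat) : (forall i j : 'I_k.+1, i < j -> r i < r j) ->
    forall j : 'I_k, r (lift ord_max j) < r ord_max.
  by move=> hr j; apply: hr; rewrite lift_max /=.
have key (r : 'I_k.+1 -> nat) : (forall i j : 'I_k.+1, i < j -> r i < r j) ->
    (Z (h \o r) <-> Z' (h \o (r \o lift ord_max))).
  move=> hr; pose X x := Z (snoc (h \o (r \o lift ord_max)) x).
  have -> : h \o r = snoc (h \o (r \o lift ord_max)) (h (r ord_max)).
    by apply: funext => i; rewrite /snoc; case: (unliftP ord_max i) => [j|] ->.
  have dX (A : set N) : (forall j, A (h (r (lift ord_max j)))) ->
      df (M := N) A (fun w : unit -> N => X (w tt)).
    move=> hA; apply: (df_sub (E := fun i (w : unit -> N) =>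
      if unlift ord_max i is Some j then h (r (lift ord_max j)) else w tt) dZ) => //.
    by move=> i; case: unlift => [j|]; [apply: vp_par|apply: vp_var].
  have gen (Y : set N) : eventual Y -> df (M := N) [set h i | i in [set i | i < r ord_max]]
      (fun w : unit -> N => Y (w tt)) -> Y (h (r ord_max)).
    move=> eY dY; apply: hh (df_reduct dY).
    by case: odd; [apply: eventual_big_coset|apply: eventual_big].
  have dX' : df (M := N) [set h i | i in [set i | i < r ord_max]]
      (fun w : unit -> N => X (w tt)).
    by apply: dX => j; exists (r (lift ord_max j)) => //; apply: lmax.
  split=> [zr|eX]; last exact: (gen X).
  have [//|eX] : eventual X \/ eventual (~` X).
    by apply: eventual_dec => //; apply/definable1P; apply: dX.
  by have := gen (~` X) eX (df_not dX') zr.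
rewrite (key s hs) (key t ht); apply: IH => // i j ij; [apply: hs|apply: ht];
  by rewrite !lift_max.
Qed.

Lemma generic_even_dcl n : ~~ odd n -> ~ dcl N (U `|` [set h i | i in [set i | i < n]]) (h n).
Proof.
move=> /negbTE on d.
pose w y (i : unit + 'I_n) := match i with inl _ => y | inr i => h i end.
have [m [Y [dY hY]]] : exists m (Y : (unit + 'I_n + 'I_m -> M) -> Prop),
    df (M := N) set0 Y /\ dcl_witness Y (w (h n)).
  apply/dcl_witnessP => /=; apply: dcl_mono d => x [Ux|[i ni <-]]; first by left.
  by right; exists (Ordinal ni).
suff : ~ dcl_witness Y (w (h n)) by apply.
apply: (hh (X := fun y => ~ dcl_witness Y (w y))).
  rewrite on; have [c] := carrier_inhabited M.
  (* With the formula [Y] and the predecessors fixed, the points to be avoided form a thin set. *)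
  exists c, [set y | dcl_witness Y (w y)]; split=> //.
  apply: (@thin_image _ N U 'I_m (fun o => Y (sumcat
    (sumcat (fun=> o None) (fun i : 'I_n => h i)) (fun i => o (Some i))))).
  apply: (df_sub (M := N) (E := fun i (o : option 'I_m -> N) => match i with
    | inl (inl _) => o None | inl (inr i) => h (nat_of_ord i) | inr j => o (Some j) end) dY) => //.
  by move=> [[?|?]|?]; solve_vp.
apply: df_not.
apply: (df_sub (E := fun i (v : unit -> M) => w (v tt) i) (df_dcl_witness dY)) => //.
by move=> [?|i]; [apply: vp_var|apply: vp_par; exists i => /=].
Qed.

Lemma generic_odd n : odd n -> exists u, U u /\ h n = madd (M := N) (h 0) u.
Proof.
move=> on; apply: (hh (X := fun y => exists u, U u /\ y = madd (M := N) (h 0) u)).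
  by rewrite on; have [c] := carrier_inhabited M; exists c.
apply: df_ex; apply: df_and; first by apply: df_Uset; apply: vp_var.
apply: df_reduct; apply: df_add; try exact: vp_var.
by apply: vp_par; exists 0 => //=; case: (n) on.
Qed.

End Properties.
End GenericSequence.

(** * Stretching the sequence *)

Section Stretching.
Variables (K : Type) (L : oag_language) (M : structure (langU L)).
Local Notation N := (reduct M).
Local Notation U := (Uset M).
Hypothesis om : o_minimal N.
Hypothesis og : ordered_abelian_group N.
Hypothesis small : forall A : set M, finite_set A -> card_lt K A.
Hypothesis satM : saturated K M.
Hypothesis sU : small_set N U.
Hypothesis dU : order_dense N U.

Variables (J : countType) (R : rel J) (bot c : J).
Hypothesis Rirr : irreflexive R.
Hypothesis Rtr : transitive R.
Hypothesis Rbot : forall j, j != bot -> R bot j.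
Hypothesis cbot : c != bot.

(** By compactness: each condition involves finitely many indices, and any finite part of [J] maps
    increasingly into [nat] with [c] alone at an odd place. The coding [pickle] turns families
    indexed by [J] into sequences. *)
Lemma stretch : exists a : J -> M, [/\
  forall k (Z : ('I_k -> N) -> Prop) (s t : 'I_k -> J), df set0 Z ->
    (forall i j : 'I_k, i < j -> R (s i) (s j)) ->
    (forall i j : 'I_k, i < j -> R (t i) (t j)) -> Z (a \o s) <-> Z (a \o t),
  forall j n (r : 'I_n -> J), j != c -> (forall i, R (r i) j) ->
    ~ dcl N (U `|` range (a \o r)) (a j) &
  exists u, U u /\ a c = madd (M := N) (a bot) u].
Proof.
have [h hh] := generic_sequence om og small satM sU dU.
have [x0] := carrier_inhabited M.
(* [s] agrees on the first [n] indices with a copy of [h] along [E], which sends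
   [c] to the odd positions and all other indices to the even ones *)
pose approx n (s : nat -> M) := exists E : J -> nat, [/\
  forall i j, pickle i < n -> pickle j < n -> R i j -> E i < E j,
  E bot = 0, forall j, odd (E j) = (j == c) &
  forall j, pickle j < n -> s (pickle j) = h (E j)].
have approx_mono m n s : m <= n -> approx n s -> approx m s.
  move=> mn [E [E1 E2 E3 E4]]; exists E; split=> //.
    by move=> i j im jm; apply: E1; apply: leq_trans mn.
  by move=> j jm; apply: E4; apply: leq_trans mn.
pose F X := exists n, forall s, approx n s -> X s.
have [|X Y [m hm] [n hn]|X [n hn]|a ha] := realize_sequence_type satM (F := F) small.
- by exists 0.
- by exists (maxn m n) => s hs; split; [apply: hm|apply: hn];
    apply: approx_mono hs; rewrite ?leq_maxl ?leq_maxr.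
- pose cnt j := \sum_(i < n) (if unpickle i is Some i' then R i' j : nat else 0).
  pose E j := (cnt j).*2 + (j == c).
  exists (fun m => if unpickle m is Some j then h (E j) else x0); apply: hn.
  exists E; split.
  + move=> i j im jm ij.
    suff lt : cnt i < cnt j.
      apply: leq_trans (leq_addr _ _); apply: (@leq_trans (cnt i).+1.*2).
        by rewrite doubleS ltnS -addn1 leq_add2l; case: (i == c).
      by rewrite leq_double.
    rewrite /cnt (bigD1 (Ordinal im)) //= [X in _ < X](bigD1 (Ordinal im)) //=.
    rewrite pickleK Rirr ij add0n add1n ltnS; apply: leq_sum => l _.
    case: unpickle => // l'; case e: (R l' i) => //.
    by rewrite (Rtr e ij).
  + rewrite /E eq_sym (negbTE cbot) addn0 /cnt big1 // => i _.
    case: unpickle => // j; case e: (R j bot) => //.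
    have [jb|/Rbot bj] := eqVneq j bot; first by rewrite jb Rirr in e.
    by have := Rtr bj e; rewrite Rirr.
  + by move=> j; rewrite /E oddD odd_double; case: (j == c).
  + by move=> j _; rewrite pickleK.
have bound n (r : 'I_n -> J) : exists m, forall i, pickle (r i) < m.
  exists (\max_(i < n) (pickle (r i)).+1) => i.
  exact: (@leq_bigmax _ (fun i => (pickle (r i)).+1)).
exists (fun j => a (pickle j)); split.
- move=> k Z s t dZ hs ht.
  apply: (ha (fun w => Z (w \o (pickle \o s)) <-> Z (w \o (pickle \o t)))).
    have [[m hm] [n hn]] := (bound _ s, bound _ t).
    exists (maxn m n) => w [E [E1 _ _ E4]].
    have sub r : (forall i : 'I_k, pickle (r i) < maxn m n) ->
        w \o (pickle \o r) = h \o (E \o r).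
      by move=> hr; apply: funext => i; apply: E4.
    have hm' i : pickle (s i) < maxn m n by apply: leq_trans (hm i) (leq_maxl _ _).
    have hn' i : pickle (t i) < maxn m n by apply: leq_trans (hn i) (leq_maxr _ _).
    rewrite !sub //; apply: (generic_indiscernible om hh) => // i j ij; apply: E1 => //.
      exact: hs.
    exact: ht.
  by apply: df_iff; apply: df_re; apply: df_reduct.
- move=> j n r jc hr d.
  pose w (f : nat -> M) (i : unit + 'I_n) : M :=
    match i with inl _ => f (pickle j) | inr i => f (pickle (r i)) end.
  (* A dependence is witnessed by a single formula [Y], so its failure is a condition on finitely
     many entries. *)
  have [m [Y [dY hY]]] : exists m (Y : (unit + 'I_n + 'I_m -> M) -> Prop),
      df (M := N) set0 Y /\ dcl_witness Y (w a).
    exact/(@dcl_witnessP _ M _ (w a)).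
  suff : ~ dcl_witness Y (w a) by apply.
  apply: (ha (fun f => ~ dcl_witness Y (w f))).
    have [l hl] := bound _ r; exists (maxn (pickle j).+1 l) => f [E [E1 _ E3 E4]] hf.
    have hj : pickle j < maxn (pickle j).+1 l by rewrite leq_max ltnSn.
    have hi i : pickle (r i) < maxn (pickle j).+1 l.
      by apply: leq_trans (hl i) (leq_maxr _ _).
    have : dcl N (U `|` range (fun i => w f (inr i))) (w f (inl tt)).
      by apply/dcl_witnessP; exists m, Y.
    rewrite /= E4 // => d'.
    apply: (generic_even_dcl hh (n := E j)); first by rewrite E3.
    apply: dcl_mono d' => x [Ux|[i _ <-]]; first by left.
    by right; exists (E (r i)); [apply: E1|rewrite E4].
  apply: df_not; apply: (df_sub (E := fun i f => w f i) (df_dcl_witness dY)) => //.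
  by move=> [?|?]; apply: vp_var.
- apply: (ha (fun f => exists u, U u /\ f (pickle c) = madd (M := N) (f (pickle bot)) u)).
    exists (maxn (pickle bot).+1 (pickle c).+1) => f [E [E1 E2 E3 E4]].
    rewrite !E4 ?E2; try by rewrite leq_max ltnSn ?orbT.
    by apply: (generic_odd hh); rewrite E3 eqxx.
  apply: df_ex; apply: df_and; first by apply: df_Uset; apply: vp_var.
  by apply: df_reduct; apply: df_add; apply: vp_var.
Qed.

End Stretching.

(** * Independent tuples and equality of types *)

Section Independence.
Variables (L : oag_language) (N : structure L).
Hypothesis om : o_minimal N.
Implicit Types A : set N.

Lemma dcl_mem A x : A x -> dcl N A x.
Proof. by move=> Ax; apply/dclP; apply: df_eq; [apply: vp_var|apply: vp_par]. Qed.

Definition others n (a : 'I_n -> N) (i : 'I_n) := [set a j | j in [set j | j != i]].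

Lemma independentP A n (a : 'I_n -> N) :
  (forall i, ~ dcl N (A `|` others a i) (a i)) -> dcl_independent N A a.
Proof.
move=> h; split=> // i j e; apply/eqP/negP => ij.
apply: (h i); apply: dcl_mem; right; exists j => //=; apply/eqP => ji.
by apply: ij; rewrite ji.
Qed.

(** If an earlier entry depended on the others only through the last one, exchange would make the
    last entry depend on the earlier ones. *)
Lemma sequentially_independent A n (a : 'I_n -> N) :
  (forall i : 'I_n, ~ dcl N (A `|` [set a j | j in [set j : 'I_n | j < i]]) (a i)) ->
  forall i, ~ dcl N (A `|` others a i) (a i).
Proof.
elim: n a => [|n IH] a ha i; first by case: i.
have {}IH := IH (a \o lift ord_max).
case: (unliftP ord_max i) => [i'|] ->; last first.
  move=> d; apply: (ha ord_max); apply: dcl_mono d => x [Ax|[j /= jm <-]]; first by left.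
  by right; exists j => //=; rewrite ltn_neqAle jm -ltnS ltn_ord.
have nd : ~ dcl N (A `|` others (a \o lift ord_max) i') (a (lift ord_max i')).
  apply: IH => j d; apply: (ha (lift ord_max j)).
  apply: dcl_mono d => x [Ax|[l /= lj <-]]; first by left.
  by right; exists (lift ord_max l) => //; rewrite /mkset lift_max /bump [n <= j]leqNgt ltn_ord.
move=> d; have {d} : dcl N (A `|` others (a \o lift ord_max) i' `|` [set a ord_max])
    (a (lift ord_max i')).
  apply: dcl_mono d => x [Ax|[j /= ji <-]]; first by left; left.
  move: ji; case: (unliftP ord_max j) => [j'|] -> ji; last by right.
  by left; right; exists j' => //=; apply/eqP => e; rewrite e eqxx in ji.
move=> /(dcl_exchange om)/(_ nd) d; apply: (ha ord_max).
apply: dcl_mono d => x [[Ax|[j _ <-]]|->]; first by left.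
  by right; exists (lift ord_max j) => //; rewrite /mkset lift_max /= ltn_ord.
by right; exists (lift ord_max i') => //; rewrite /mkset lift_max /= ltn_ord.
Qed.

End Independence.

Lemma tp_eqP (L : language) (M : structure L) (A : set M) n (x y : 'I_n -> M) :
  tp M A x = tp M A y <-> forall Z, df A Z -> Z x <-> Z y.
Proof.
split=> [e Z /definableP[phi ->]|h]; first by rewrite /= -[psat phi x]/(tp M A x phi) e.
have e (phi : pformula A n) : psat phi x <-> psat phi y.
  by apply: (h (fun v => psat phi v)); apply/definableP; exists phi.
by apply/seteqP; split=> phi /e.
Qed.

(** * The failure of distality *)

(** Flattening a sequence of 1-tuples is a mere reindexing; injectivity of [r] is what carries
    independence over to the flattened tuple. *)
Lemma tflatten_unary k : exists2 r : 'I_(k * 1) -> 'I_k, injective r &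
  forall T (f : 'I_k -> T), tflatten (fun i (_ : 'I_1) => f i) = f \o r.
Proof.
exists (tflatten (fun i _ => i)) => [i j|T f].
  case/mxvec_indexP: i => i x; case/mxvec_indexP: j => j y.
  by rewrite /tflatten !mxvecE !mxE => ->; rewrite (ord1 x) (ord1 y).
apply: funext => i; case/mxvec_indexP: i => i x.
by rewrite /tflatten /= !mxvecE !mxE.
Qed.

Definition rat_lt (x y : rat) : Prop := (x < y)%R.

Lemma linear_rat_lt : linear_order rat_lt.
Proof.
split=> [x|x y z|x y]; rewrite /rat_lt; first by rewrite Order.POrderTheory.ltxx.
  exact: Order.POrderTheory.lt_trans.
by case: (Order.TotalTheory.ltgtP x y) => h; [apply: Or31|apply: Or33|apply: Or32].
Qed.

Lemma no_endpoints_rat_lt : no_endpoints rat_lt.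
Proof.
move=> x; split; [exists (x - 1)%R|exists (x + 1)%R]; rewrite /rat_lt.
  by rewrite Num.Theory.gtrBl Num.Theory.ltr01.
by rewrite Num.Theory.ltrDl Num.Theory.ltr01.
Qed.

Definition gap_index := (rat + (unit + rat))%type.
Definition gap_lt : gap_index -> gap_index -> Prop :=
  sum_lt rat_lt (sum_lt unit_lt rat_lt).
Definition gap : gap_index := inr (inl tt).

(** [None] is the index of the element [b], which serves as the parameter of the counterexample. *)
Definition bot_lt (x y : option gap_index) : bool :=
  match x, y with
  | None, Some _ => true
  | Some x, Some y => `[< gap_lt x y >]
  | _, None => false
  end.

Lemma bot_lt_irr : irreflexive bot_lt.
Proof.
have [irr _ _] := linear_rat_lt.
by move=> [[x|[[]|x]]|] //=; apply/asboolP => // /irr.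
Qed.

Lemma bot_lt_trans : transitive bot_lt.
Proof.
have [_ tr _] := linear_rat_lt.
move=> [y|] [x|] [z|] //= /asboolP xy /asboolP yz; apply/asboolP; move: xy yz.
by case: x => [x|[[]|x]]; case: y => [y|[[]|y]]; case: z => [z|[[]|z]] //=; apply: tr.
Qed.

Lemma skip_middle_neq i : @skip_middle rat rat i <> gap.
Proof. by case: i. Qed.

Lemma gap_lt_skip i j : sum_lt rat_lt rat_lt i j ->
  gap_lt (@skip_middle rat rat i) (@skip_middle rat rat j).
Proof. by case: i; case: j. Qed.

Section GapSequence.
Variables (L : oag_language) (M : structure (langU L)).
Local Notation N := (reduct M).
Local Notation U := (Uset M).
Hypothesis om : o_minimal N.
Hypothesis og : ordered_abelian_group N.
Variable a : option gap_index -> M.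
Hypothesis a_indisc : forall k (Z : ('I_k -> N) -> Prop) (s t : 'I_k -> option gap_index),
  df set0 Z -> (forall i j : 'I_k, i < j -> bot_lt (s i) (s j)) ->
  (forall i j : 'I_k, i < j -> bot_lt (t i) (t j)) -> Z (a \o s) <-> Z (a \o t).
Hypothesis a_indep : forall j n (r : 'I_n -> option gap_index), j != Some gap ->
  (forall i, bot_lt (r i) j) -> ~ dcl N (U `|` range (a \o r)) (a j).
Hypothesis a_gap : exists u, U u /\ a (Some gap) = madd (M := N) (a None) u.

Definition cons_bot k (s : 'I_k -> gap_index) (i : 'I_k.+1) : option gap_index :=
  omap s (unlift ord0 i).

Lemma cons_bot0 k (s : 'I_k -> gap_index) : cons_bot s ord0 = None.
Proof. by rewrite /cons_bot unlift_none. Qed.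

Lemma cons_botS k (s : 'I_k -> gap_index) j : cons_bot s (lift ord0 j) = Some (s j).
Proof. by rewrite /cons_bot liftK. Qed.

Section Increasing.
Variables (k : nat) (s : 'I_k -> gap_index).
Hypothesis s_inc : forall i j : 'I_k, i < j -> gap_lt (s i) (s j).

Lemma cons_bot_inc (i j : 'I_k.+1) : i < j -> bot_lt (cons_bot s i) (cons_bot s j).
Proof.
case: (unliftP ord0 j) => [j'|] -> //; rewrite cons_botS.
case: (unliftP ord0 i) => [i'|] ->; rewrite ?cons_bot0 // cons_botS /= => ij.
by apply/asboolP/s_inc.
Qed.

Hypothesis s_gap : forall i, s i <> gap.

Lemma cons_bot_indep i : ~ dcl N (U `|` others (N := N) (a \o cons_bot s) i) (a (cons_bot s i)).
Proof.
apply: (sequentially_independent om (a := a \o cons_bot s)) => {}i d.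
pose r (l : 'I_i) := cons_bot s (Ordinal (ltn_trans (ltn_ord l) (ltn_ord i))).
apply: (a_indep (j := cons_bot s i) (r := r)).
- case: (unliftP ord0 i) => [j|] ->; rewrite ?cons_bot0 // cons_botS.
  by apply/eqP => -[]; apply: s_gap.
- by move=> l; apply: cons_bot_inc => /=.
- apply: dcl_mono d => x [Ux|[j /= ji <-]]; [by left|right].
  by exists (Ordinal ji) => //; rewrite /r /=; congr (a (cons_bot s _)); apply: val_inj.
Qed.

Lemma others_lift i j : j != i ->
  others (N := N) (a \o cons_bot s) (lift ord0 i) (a (Some (s j))).
Proof.
move=> ji; exists (lift ord0 j); last by rewrite /= cons_botS.
by move=> /=; apply: contra ji => /eqP/lift_inj ->.
Qed.

Lemma others_bot i : others (N := N) (a \o cons_bot s) (lift ord0 i) (a None).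
Proof. by exists ord0; rewrite /= ?cons_bot0. Qed.

Lemma avoiding_gap_indep i :
  ~ dcl N ([set a None] `|` U `|` others (N := N) (a \o (Some \o s)) i) (a (Some (s i))).
Proof.
move=> d; apply: (@cons_bot_indep (lift ord0 i)); rewrite cons_botS.
apply: dcl_mono d => x [[->|Ux]|[j /= ji <-]]; first by right; apply: others_bot.
  by left.
by right; apply: others_lift.
Qed.

End Increasing.

(** [a None] and [a (Some gap)] differ by an element of [U], so over [U] each can stand in for the
    other. *)
Lemma gap_dcl A : U `<=` A -> A (a None) -> dcl N A (a (Some gap)).
Proof.
move=> UA Ab; have [u [Uu ->]] := a_gap; apply/dclP.
by apply: df_add; [apply: vp_par|apply: vp_par; apply: UA|apply: vp_var].
Qed.

Lemma bot_dcl A : U `<=` A -> A (a (Some gap)) -> dcl N A (a None).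
Proof.
move=> UA Ac; have [u [Uu e]] := a_gap; apply/dclP.
have [[addA addC add0 inv] _] := og; have [u' hu'] := inv u.
have h (w : unit -> N) : a (Some gap) = madd (w tt) u <-> w tt = a None.
  split=> [|->//]; rewrite e => h.
  have {}h : madd (madd (a None : N) u) u' = madd (madd (w tt) u) u' by rewrite h.
  by move: h; rewrite -!addA (addC u u') hu' !(addC _ (mzero N)) !add0.
apply: df_ext h _.
by apply: df_add; [apply: vp_var|apply: vp_par; apply: UA|apply: vp_par].
Qed.

(** If the gap occurs, at [i0] say, its entry is replaced by [a None], interdefinable with it over
    [U]. The remaining entries together with [a None] avoid the gap, so their independence is
    already known. *)
Lemma all_indep k (s : 'I_k -> gap_index) : (forall i j : 'I_k, i < j -> gap_lt (s i) (s j)) ->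
  forall i, ~ dcl N (U `|` others (N := N) (a \o (Some \o s)) i) (a (Some (s i))).
Proof.
move=> s_inc i; have [[i0 ei0]|ng] := pselect (exists i0, s i0 = gap); last first.
  have s_gap j : s j <> gap by move=> sj; apply: ng; exists j.
  move=> d; apply: (avoiding_gap_indep s_inc s_gap (i := i)).
  by apply: dcl_mono d => x [Ux|ox]; [left; right|right].
case: k s s_inc i i0 ei0 => [|k] s s_inc i i0 ei0; first by case: i.
have sl_inc (l j : 'I_k) : l < j -> gap_lt ((s \o lift i0) l) ((s \o lift i0) j).
  by move=> lj; apply: s_inc; rewrite /= ltnNge leq_bump2 -ltnNge.
have sl_gap j : (s \o lift i0) j <> gap.
  move=> /= e; have := neq_lift i0 j; rewrite -val_eqE neq_ltn.
  by case/orP => /s_inc; rewrite e ei0.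
case: (unliftP i0 i) => [i'|] ->; last first.
  rewrite ei0 => d; apply: (cons_bot_indep sl_inc sl_gap (i := ord0)); rewrite cons_bot0.
  have d' : dcl N (U `|` others (N := N) (a \o cons_bot (s \o lift i0)) ord0) (a (Some gap)).
    apply: dcl_mono d => x [Ux|[j /= ji <-]]; [by left|right].
    move: ji; case: (unliftP i0 j) => [j'|] ->; last by rewrite eqxx.
    by exists (lift ord0 j') => //=; rewrite cons_botS.
  apply: (dcl_trans _ d'); apply: bot_dcl => [x Ux|]; by [left; left|right].
move=> d; apply: (avoiding_gap_indep sl_inc sl_gap (i := i')).
apply: (@dcl_trans _ N _ (a (Some gap))); last first.
  by apply: gap_dcl => [x Ux|]; left; [right|left].
apply: dcl_mono d => x [Ux|[j /= ji <-]]; first by left; left; right.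
move: ji; case: (unliftP i0 j) => [j'|] -> ji; last by right; rewrite /= ei0.
by left; right; exists j' => //=; apply: contra ji => /eqP ->.
Qed.

Hypothesis tp_indep : forall n (C : set M) (x y : 'I_n -> M), finite_set C ->
  dcl_independent N (C `|` U) x -> dcl_independent N (C `|` U) y ->
  tp N C x = tp N C y -> tp M C x = tp M C y.

Lemma tp_tflatten (C : set M) k (x y : 'I_k -> M) : finite_set C ->
  (forall i, ~ dcl N (C `|` U `|` others (N := N) x i) (x i)) ->
  (forall i, ~ dcl N (C `|` U `|` others (N := N) y i) (y i)) ->
  (forall Z, df (M := N) C Z -> Z x <-> Z y) ->
  tp M C (tflatten (fun i (_ : 'I_1) => x i)) = tp M C (tflatten (fun i (_ : 'I_1) => y i)).
Proof.
move=> fC ix iy e; have [r r_inj rE] := tflatten_unary k; rewrite !rE.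
have ind z : (forall i, ~ dcl N (C `|` U `|` others (N := N) z i) (z i)) ->
    dcl_independent N (C `|` U) (z \o r).
  move=> iz; apply: independentP => i d; apply: (iz (r i)).
  apply: dcl_mono d => t [ht|[j /= ji <-]]; [by left|right].
  by exists (r j) => //=; apply: contra ji => /eqP/r_inj ->.
apply: tp_indep => //; [exact: ind|exact: ind|].
by apply/(@tp_eqP _ N) => Z dZ; apply: e (df_re r dZ).
Qed.

Local Notation c := (fun x (_ : 'I_1) => a (Some x)).

Lemma whole_indiscernible : indiscernible M set0 gap_lt c.
Proof.
move=> k s t hs ht.
apply: (@tp_tflatten set0 k (a \o (Some \o s)) (a \o (Some \o t))).
- exact: finite_set0.
- by move=> i; rewrite set0U; apply: all_indep.
- by move=> i; rewrite set0U; apply: all_indep.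
- by move=> Z dZ; apply: a_indisc => // i j ij; apply/asboolP; [apply: hs|apply: ht].
Qed.

Lemma skipped_indiscernible :
  indiscernible M [set a None] (sum_lt rat_lt rat_lt) (c \o @skip_middle rat rat).
Proof.
move=> k s t hs ht.
have inc r : (forall i j : 'I_k, i < j -> sum_lt rat_lt rat_lt (r i) (r j)) ->
    forall i j : 'I_k, i < j -> gap_lt ((@skip_middle _ _ \o r) i) ((@skip_middle _ _ \o r) j).
  by move=> hr i j ij; apply: gap_lt_skip; apply: hr.
apply: (@tp_tflatten [set a None] k (a \o (Some \o (@skip_middle _ _ \o s)))
  (a \o (Some \o (@skip_middle _ _ \o t)))).
- exact: finite_set1.
- by apply: avoiding_gap_indep; [apply: inc|move=> i; apply: skip_middle_neq].
- by apply: avoiding_gap_indep; [apply: inc|move=> i; apply: skip_middle_neq].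
(* The parameter [a None] is made the first variable. Its index lies below all others, so the
   extended tuples are still increasing and indiscernibility without parameters applies. *)
move=> Z; rewrite -[X in df X]set0U => /df_abs1[Y [dY hY]].
pose r (i : 'I_k + unit) : 'I_k.+1 := if i is inl j then lift ord0 j else ord0.
have e q : Z (a \o (Some \o q)) <-> Y ((a \o cons_bot q) \o r).
  apply: iff_trans (hY _) _; suff -> : (a \o cons_bot q) \o r =
    @sumcat _ N _ _ (a \o (Some \o q)) (fun _ : unit => a None) by [].
  by apply: funext => -[i|[]] /=; rewrite ?cons_botS ?cons_bot0.
apply: iff_trans (e _) (iff_trans _ (iff_sym (e _))).
apply: (a_indisc (Z := fun w => Y (w \o r))); first exact: df_re.
  by apply: cons_bot_inc; apply: inc.
by apply: cons_bot_inc; apply: inc.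
Qed.

Lemma gap_not_indiscernible : ~ indiscernible M [set a None] gap_lt c.
Proof.
move=> /(_ 1 (fun=> gap) (fun=> inl 0%R)).
have no (P : 'I_1 -> 'I_1 -> Prop) : forall i j : 'I_1, i < j -> P i j.
  by move=> i j; rewrite (ord1 i) (ord1 j).
move=> /(_ (no _) (no _)); have [r _ rE] := tflatten_unary 1.
rewrite (rE _ (fun=> a (Some gap))) (rE _ (fun=> a (Some (inl 0%R)))).
move=> /tp_eqP/(_ (fun w => exists u, U u /\ w ord0 = madd (M := N) (a None) u)).
case=> [|/(_ a_gap)[u [Uu e]] _].
  apply: df_ex; apply: df_and; first by apply: df_Uset; apply: vp_var.
  by apply: df_reduct; apply: df_add; [apply: vp_par|apply: vp_var|apply: vp_var].
(* An entry other than the one at the gap would, by lying in the coset of [a None], be in [dcl] of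
   [a None] and [U]. *)
apply: (@avoiding_gap_indep 1 (fun=> inl 0%R) (no _) _ ord0) => //.
apply/dclP; rewrite [a (Some _)]e; apply: df_add; last exact: vp_var.
  by apply: vp_par; left; left.
by apply: vp_par; left; right.
Qed.

End GapSequence.

Theorem theorem5p1 (L : oag_language) (T : theory L) (TU : theory (langU L))
    (K : Type) (M : structure (langU L)) :
  o_minimal_theory T -> extends_oag T ->
  complete_theory TU -> expands TU T ->
  monster_model K TU M ->
  small_set (reduct M) (Uset M) -> order_dense (reduct M) (Uset M) ->
  (forall (n : nat) (C : set M) (a b : 'I_n -> M),
     card_lt K C ->
     dcl_independent (reduct M) (C `|` Uset M) a ->
     dcl_independent (reduct M) (C `|` Uset M) b ->
     tp (reduct M) C a = tp (reduct M) C b ->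
     tp M C a = tp M C b) ->
  ~ distal K M.
Proof.
move=> Tom Tog _ TUT [MTU cK satM _] sU dU ind.
have NT : models (reduct M) T.
  by move=> phi /TUT/(_ _ MTU) h v; apply/sat_formulaU.
have om := Tom _ NT; have og := Tog _ NT.
have small (A : set M) : finite_set A -> card_lt K A by apply: finite_card_lt cK.
have [|//|a [a1 a2 a3]] := @stretch K _ M om og small satM sU dU _ bot_lt None (Some gap)
  bot_lt_irr bot_lt_trans; first by case.
have ind' n (C : set M) x y := fun fC => @ind n C x y (small C fC).
move=> dist; apply: (gap_not_indiscernible om a2 a3).
apply: (dist [set a None] 1 rat rat rat_lt rat_lt).
- by apply: small; apply: finite_set1.
- exact: linear_rat_lt.
- exact: infinite_rat.
- exact: no_endpoints_rat_lt.
- exact: linear_rat_lt.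
- exact: infinite_rat.
- exact: no_endpoints_rat_lt.
- exact: (whole_indiscernible om og a1 a2 a3 ind').
- exact: (skipped_indiscernible om a1 a2 ind').
Qed.
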